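(* Let $(e_i)$ be a normalized Schauder basis of a reflexive Banach space $X$ which is $C$-Schreier unconditional for some $C<\infty$, i.e. $$\Big\|\sum_{i\in F}a_ie_i\Big\|\le C\Big\|\sum_i a_ie_i\Big\|$$ for all $F\in S_1$ and all scalars $(a_i)$. If $|SP_w(X)|=|SP_w(X^* )|=1$, then the unique spreading model in $SP_w(X)$ is equivalent to the unit vector basis of $c_0$ or of $\ell_p$ for some $1\le p<\infty$.
   Context: $S_1$ (the first Schreier class) is the family of finite sets $F\subseteq\mathbb N$ with $|F|\le\min F$. A normalized basic sequence $(x_i)$ generates a spreading model $(\tilde x_i)$ if there exist $\varepsilon_n\downarrow 0$ such that for all $n$, all $(a_i)_{i=1}^n\subseteq[-1,1]$ and all $n\le k_1<\cdots<k_n$, $(1+\varepsilon_n)^{-1}\|\sum_{i=1}^n a_i\tilde x_i\|\le\|\sum_{i=1}^n a_ix_{k_i}\|\le(1+\varepsilon_n)\|\sum_{i=1}^n a_i\tilde x_i\|$. Two sequences are equivalent if each dominates the other up to a constant, i.e. $C^{-1}\|\sum a_iv_i\|\le\|\sum a_iu_i\|\le C\|\sum a_iv_i\|$ for all finitely supported $(a_i)$. $SP_w(Z)$ is the set of equivalence classes of spreading models generated by normalized weakly null sequences in $Z$. *)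

(* Defs.v *)
From HB Require Import structures.
From mathcomp Require Import all_boot all_order all_algebra.
From mathcomp Require Import all_classical all_reals all_analysis.
Set Implicit Arguments. Unset Strict Implicit. Unset Printing Implicit Defensive.
Import Order.TTheory GRing.Theory Num.Theory.
Import numFieldNormedType.Exports.
Local Open Scope classical_set_scope.
Local Open Scope ring_scope.

(* Sequences are indexed from 0: [x 0] is the paper's x_1. *)

(** Schreier family S_1 (shifted to 0-indexing): a finite set F (a duplicate
    free list) of indices with |F| <= min F, where index i stands for the
    paper's natural number i+1.  The empty set belongs to S_1. *)
Definition schreier1 (F : seq nat) : Prop :=
  uniq F /\ (forall i, i \in F -> (size F <= i.+1)%N).

Section Defs.
Variable R : realType.

Definition schauder_basis (X : normedModType R) (e : nat -> X) : Prop :=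
  forall x : X,
    (exists a : nat -> R, (fun n => \sum_(i < n) a i *: e i) @ \oo --> x) /\
    (forall a b : nat -> R,
        (fun n => \sum_(i < n) a i *: e i) @ \oo --> x ->
        (fun n => \sum_(i < n) b i *: e i) @ \oo --> x -> a = b).

Definition schreier_unconditional (X : normedModType R) (e : nat -> X) (C : R)
  : Prop :=
  forall (n : nat) (a : nat -> R) (F : seq nat), schreier1 F ->
    `| \sum_(i < n | (i : nat) \in F) a i *: e i | <= C * `| \sum_(i < n) a i *: e i |.

(** Generic "normed space" given as a subspace S of an lmodType V with norm N.
    This is used both for X itself (V = X, S = setT, N = norm) and for the
    dual X^* (V = X -> R, S = bounded linear functionals, N = operator norm). *)
Definition linear_on (V : lmodType R) (S : set V) (Phi : V -> R) : Prop :=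
  forall (a : R) (u v : V), S u -> S v -> Phi (a *: u + v) = a * Phi u + Phi v.

Definition bounded_on (V : lmodType R) (S : set V) (N : V -> R) (Phi : V -> R)
  : Prop := exists K : R, forall u, S u -> `|Phi u| <= K * N u.

Definition bdd_functional (V : lmodType R) (S : set V) (N : V -> R)
  (Phi : V -> R) : Prop := linear_on S Phi /\ bounded_on S N Phi.

Definition normalized_weakly_null (V : lmodType R) (S : set V) (N : V -> R)
  (x : nat -> V) : Prop :=
  (forall n, S (x n)) /\ (forall n, N (x n) = 1) /\
  (forall Phi : V -> R, bdd_functional S N Phi -> Phi \o x @ \oo --> (0 : R)).

(** (x_i) in (V, N) generates the spreading model (xt_i) in the normed
    space W (0-indexed: k_1 >= n becomes (k 0).+1 >= n). *)
Definition generates_spreading_model (V : lmodType R) (N : V -> R)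
  (x : nat -> V) (W : normedModType R) (xt : nat -> W) : Prop :=
  exists eps : nat -> R,
    {homo eps : m n / (m <= n)%N >-> n <= m} /\ eps @ \oo --> (0 : R) /\
    forall (n : nat) (a : nat -> R) (k : nat -> nat),
      (forall i, (i < n)%N -> -1 <= a i <= 1) ->
      (forall i, (i.+1 < n)%N -> (k i < k i.+1)%N) ->
      (n <= (k 0%N).+1)%N ->
      (1 + eps n)^-1 * `| \sum_(i < n) a i *: xt i |
        <= N (\sum_(i < n) a i *: x (k i)) /\
      N (\sum_(i < n) a i *: x (k i)) <= (1 + eps n) * `| \sum_(i < n) a i *: xt i |.

Definition comb_norm (W : normedModType R) (u : nat -> W) : nat -> (nat -> R) -> R :=
  fun n a => `| \sum_(i < n) a i *: u i |.

(** Equivalence of two (basic) sequences, expressed through the norms of their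
    finite linear combinations [M n a = || sum_(i<n) a_i u_i ||]. *)
Definition equiv_seq (M1 M2 : nat -> (nat -> R) -> R) : Prop :=
  exists C : R, 0 < C /\
    forall (n : nat) (a : nat -> R), C^-1 * M2 n a <= M1 n a <= C * M2 n a.

Definition c0_norm : nat -> (nat -> R) -> R :=
  fun n a => \big[Num.max/0]_(i < n) `|a i|.

Definition lp_norm (p : R) : nat -> (nat -> R) -> R :=
  fun n a => (\sum_(i < n) `|a i| `^ p) `^ p^-1.

Definition SPw_single (V : lmodType R) (S : set V) (N : V -> R) : Prop :=
  (exists (x : nat -> V) (W : normedModType R) (xt : nat -> W),
      normalized_weakly_null S N x /\ generates_spreading_model N x xt) /\
  (forall (x1 : nat -> V) (W1 : normedModType R) (xt1 : nat -> W1)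
          (x2 : nat -> V) (W2 : normedModType R) (xt2 : nat -> W2),
      normalized_weakly_null S N x1 -> generates_spreading_model N x1 xt1 ->
      normalized_weakly_null S N x2 -> generates_spreading_model N x2 xt2 ->
      equiv_seq (comb_norm xt1) (comb_norm xt2)).

Definition dual_set (X : normedModType R) : set (X -> R^o) :=
  [set f | bdd_functional [set: X] (fun x : X => `|x|) f].

Definition dual_norm (X : normedModType R) (f : X -> R^o) : R :=
  sup [set `|f x| | x in [set x : X | `|x| <= 1]].

Definition reflexive_space (X : normedModType R) : Prop :=
  forall Phi : (X -> R^o) -> R,
    bdd_functional (@dual_set X) (@dual_norm X) Phi ->
    exists x : X, forall f, @dual_set X f -> Phi f = f x.

End Defs.

(* Main.v *)
Require Import Defs.
From HB Require Import structures.
From mathcomp Require Import all_boot all_order all_algebra.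
From mathcomp Require Import all_classical all_reals all_analysis.
From mathcomp Require Import ring lra zify.
Import Order.TTheory GRing.Theory Num.Theory.
Import numFieldNormedType.Exports.
Local Open Scope classical_set_scope.
Local Open Scope ring_scope.
Set Implicit Arguments. Unset Strict Implicit. Unset Printing Implicit Defensive.

(** Let [E] be the norm of a spreading model of (a subsequence of) the basis and
    [Es] that of the normalized coordinate functionals along the same
    subsequence.  Schreier unconditionality makes [Es] equivalent to the dual norm
    of [E], and both are unconditional.

    For finite [a] and [b] let [tens a b] have the entries [a i * b j], so that
    [E (tens a b)] is the norm of the combination with coefficients [a] of
    consecutive copies of the block [b].  If [E (tens a b) <= K * E a * E b] failed
    for every [K], bad blocks [b_j] (for [K = 4 ^ j]) could be glued into the
    vectors [sum_j 2^-j b_j], placed further and further out.  By Schreier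
    unconditionality a spreading model of their normalizations dominates each [b_j]
    up to [2 ^ j], which contradicts uniqueness.  The same holds for [Es], and by
    duality [E a * E b <= K' * E (tens a b)].

    Hence the norm of [1 + ... + 1] ([n] terms) is multiplicative up to a constant and
    so comparable with [n ^ al], [0 <= al <= 1].  If [al = 0] this is c_0.  Otherwise
    [p := 1 / al]: the entries of the [r]-th tensor power of [a] lie in [O(r)] dyadic
    levels, on each of which [E] and the l_p norm agree up to a constant.  Comparing
    the norms of the powers and taking [r]-th roots gives [E a] within a constant
    of [|a|_p]. *)

(** * Iterated ultrafilter limits and the Brunel-Sucheston theorem *)

(** Schreier unconditionality bounds projections only onto sets [F] with [|F| <= min F], so the
    basis itself need not be unconditional. But any fixed number of coordinates forms such a set
    once moved far enough out, and a spreading model sees only such configurations; hence every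
    estimate is made far out and passed to the limit. Gluing yields upper estimates only: projecting
    onto one block of each glued vector bounds that block by the whole. The lower estimate has to
    come from the dual space, and this is where the second uniqueness hypothesis enters. The weights
    [2^-j] keep the glued vectors bounded while isolating the [j]-th block costs [2^j]; violations
    of size [4^j] outgrow this loss. Reflexivity makes normalized sequences with eventually
    vanishing coordinates weakly null, in [X] and in its dual, so that uniqueness applies to the
    glued vectors on either side. *)

Definition ulim (R : realType) (U : set_system nat) (f : nat -> R) : R :=
  sup [set r | U [set k | r <= f k]].

(** An ultrafilter contains each superlevel set of [f] or its complement, so [f] is eventually
    squeezed around the supremum. All later arguments use [ulim] through this property alone. *)
Lemma ulimP (R : realType) (U : set_system nat) (f : nat -> R) (B e : R) :
  UltraFilter U -> (forall k, `|f k| <= B) -> 0 < e ->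
  U [set k | `|f k - ulim U f| <= e].
Proof.
move=> UU fB e0; have PU := ultra_proper.
set A := [set r | U [set k | r <= f k]].
have ub : ubound A B.
  move=> r /filter_ex[k] /= rk; apply: le_trans rk _.
  by apply: le_trans (fB k); exact: ler_norm.
have AB : A (- B).
  rewrite /A /=; apply: filterS (filterT : U setT) => k _ /=.
  by have := fB k; rewrite ler_norml => /andP[].
have hs : has_sup A by split; [exists (- B)|exists B].
have [r Ar rl] := sup_adherent e0 hs.
have U1 : U [set k | ulim U f - e <= f k].
  by apply: filterS Ar => k /= rk; apply: le_trans rk; exact: ltW.
have U2 : U (~` [set k | ulim U f + e <= f k]).
  have [H|//] := in_ultra_setVsetC [set k | ulim U f + e <= f k] UU.
  have : ulim U f + e <= ulim U f by apply: ub_le_sup => //; exists B.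
  by rewrite gerDl leNgt e0.
apply: filterS (filterI U1 U2) => k /= [h1 /negP]; rewrite -ltNge => h2.
by rewrite ler_distl h1 ltW.
Qed.

Lemma mkseqS_shift (T : Type) (c : nat -> T) n :
  mkseq c n.+1 = c 0%N :: mkseq (fun i => c i.+1) n.
Proof. by rewrite /mkseq /= -[1%N]addn0 iotaDl -map_comp. Qed.

Section seminorm.
Variables (R : realType) (V : lmodType R) (N : V -> R).

Definition seminorm : Prop :=
  (forall u v, N (u + v) <= N u + N v) /\
  (forall (a : R) u, N (a *: u) = `|a| * N u).

Hypothesis sN : seminorm.

Lemma seminormD u v : N (u + v) <= N u + N v. Proof. exact: (proj1 sN). Qed.
Lemma seminormZ (a : R) u : N (a *: u) = `|a| * N u. Proof. exact: (proj2 sN). Qed.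
Lemma seminorm0 : N 0 = 0.
Proof. by rewrite -(scale0r (0 : V)) seminormZ normr0 mul0r. Qed.
Lemma seminormN u : N (- u) = N u.
Proof. by rewrite -scaleN1r seminormZ normrN1 mul1r. Qed.
Lemma seminorm_ge0 u : 0 <= N u.
Proof.
by have := seminormD u (- u); rewrite subrr seminorm0 seminormN -mulr2n pmulrn_lge0.
Qed.
Lemma seminorm_dist u v : `|N u - N v| <= N (u - v).
Proof.
have := seminormD (u - v) v; have := seminormD (v - u) u.
rewrite !subrK -(opprB u v) seminormN ler_norml => h1 h2.
by apply/andP; split; lra.
Qed.
Lemma seminorm_sum (I : Type) (r : seq I) (P : pred I) (F : I -> V) :
  N (\sum_(i <- r | P i) F i) <= \sum_(i <- r | P i) N (F i).
Proof.
elim/big_rec2: _ => [|i y x _ h]; first by rewrite seminorm0.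
by apply: le_trans (seminormD _ _) _; rewrite lerD2l.
Qed.

(** [E] is the norm of the spreading model of [x], with an explicit rate of
    convergence. *)
Definition asym (x : nat -> V) (E : nat -> (nat -> R) -> R) : Prop :=
  forall n a k M, 0 <= M -> (forall i, (i < n)%N -> `|a i| <= M) ->
    (forall i, (i.+1 < n)%N -> (k i < k i.+1)%N) -> (n <= (k 0%N).+1)%N ->
    `|N (\sum_(i < n) a i *: x (k i)) - E n a| <= M / (k 0%N).+1%:R.

(** Iterated limits along an ultrafilter stand in for Ramsey's theorem. *)
Fixpoint iter_ulim (U : set_system nat) (x : nat -> V) (s : seq R) (v : V) : R :=
  if s is a :: s' then ulim U (fun k => iter_ulim U x s' (v + a *: x k))
  else N v.

(** Both estimates go through one induction because the bound is what makes the next [ulim] a true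
    limit. *)
Lemma iter_ulim_lip (U : set_system nat) (x : nat -> V) (B : R) :
  UltraFilter U -> (forall k, N (x k) <= B) ->
  forall n (a b : nat -> R) u v,
  `|iter_ulim U x (mkseq a n) u| <= N u + B * \sum_(i < n) `|a i| /\
  `|iter_ulim U x (mkseq a n) u - iter_ulim U x (mkseq b n) v| <=
     N (u - v) + B * \sum_(i < n) `|a i - b i|.
Proof.
move=> UU xB; have PU := ultra_proper.
elim=> [|n IH] a b u v.
  by rewrite /= !big_ord0 !mulr0 !addr0 ger0_norm ?seminorm_ge0 // seminorm_dist.
rewrite !mkseqS_shift /= !big_ord_recl /=.
have bnd c w k : `|iter_ulim U x (mkseq (fun i => c i.+1) n) (w + c 0%N *: x k)|
   <= N w + B * (`|c 0%N| + \sum_(i < n) `|c i.+1|).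
  have [h _] := IH (fun i => c i.+1) b (w + c 0%N *: x k) v.
  apply: le_trans h _; rewrite mulrDr addrA lerD2r.
  apply: le_trans (seminormD _ _) _; rewrite lerD2l seminormZ mulrC.
  by rewrite ler_wpM2r.
split.
  apply/ler_addgt0Pr => e e0.
  have [k /= hk] := filter_ex (ulimP UU (bnd a u) e0).
  move: hk; set l := ulim _ _ => hk; have := bnd a u k.
  set z := iter_ulim _ _ _ _ in hk *; move=> hz.
  have -> : l = z - (z - l) by ring.
  by apply: le_trans (ler_normB _ _) _; apply: lerD.
apply/ler_addgt0Pr => e e0.
have e2 : 0 < e / 2 by rewrite divr_gt0.
have [k /= []] := filter_ex (filterI (ulimP UU (bnd a u) e2) (ulimP UU (bnd b v) e2)).
set l1 := ulim _ _; set l2 := ulim _ _.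
set z1 := iter_ulim _ _ _ _; set z2 := iter_ulim _ _ _ _ => h1 h2.
have [_ hz] := IH (fun i => a i.+1) (fun i => b i.+1) (u + a 0%N *: x k) (v + b 0%N *: x k).
have {}hz : `|z1 - z2| <= N (u - v) + B * (`|a 0%N - b 0%N| + \sum_(i < n) `|a i.+1 - b i.+1|).
  apply: le_trans hz _; rewrite mulrDr addrA lerD2r.
  rewrite opprD addrACA -scalerBl.
  apply: le_trans (seminormD _ _) _; rewrite lerD2l seminormZ mulrC.
  by rewrite ler_wpM2r.
have -> : l1 - l2 = (z1 - z2) - ((z1 - l1) - (z2 - l2)) by ring.
apply: le_trans (ler_normB _ _) _; apply: lerD => //.
apply: le_trans (ler_normB _ _) _; rewrite [leRHS](splitr e); exact: lerD.
Qed.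

Definition upd (T : Type) (f : nat -> T) (d : nat) (g : T) (j : nat) : T :=
  if j == d then g else f j.

(** Compactness of the cube [[-1, 1]^d]: one coordinate at a time is rounded to a finite grid, and a
    filter is closed under the resulting finite intersections. *)
Lemma equilip_uniform (U : set_system nat) (UF : Filter U) (B : R) d
    (phi : nat -> (nat -> R) -> R) (psi : (nat -> R) -> R) :
  0 <= B ->
  (forall k t t', `|phi k t - phi k t'| <= B * \sum_(j < d) `|t j - t' j|) ->
  (forall t t', `|psi t - psi t'| <= B * \sum_(j < d) `|t j - t' j|) ->
  (forall t e, 0 < e -> U [set k | `|phi k t - psi t| <= e]) ->
  forall e, 0 < e ->
  U [set k | forall t, (forall j, `|t j| <= 1) -> `|phi k t - psi t| <= e].
Proof.
move=> B0; elim: d phi psi => [|d IH] phi psi lphi lpsi pw e e0.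
  apply: filterS (pw (fun=> 0) e e0) => k /= hk t _.
  move: (lphi k t (fun=> 0)) (lpsi t (fun=> 0)).
  by rewrite !big_ord0 mulr0 !normr_le0 !subr_eq0 => /eqP-> /eqP->.
(* With mesh [1 / q.+1], rounding the last coordinate costs at most [e / 4] for [phi] and again for
   [psi]; the induction hypothesis on the grid uses the other [e / 2]. *)
pose q := Num.truncn (4 * B / e).
have qB : B / q.+1%:R <= e / 4.
  rewrite ler_pdivrMr ?ltr0n //.
  have : 4 * B / e < q.+1%:R by apply: truncnS_gt.
  rewrite ltr_pdivrMr // => h; lra.
pose g (i : 'I_(2 * q.+1).+1) : R := i%:R / q.+1%:R - 1.
have H (i : 'I_(2 * q.+1).+1) : U [set k | forall t, (forall j, `|t j| <= 1) ->
    `|phi k (upd t d (g i)) - psi (upd t d (g i))| <= e / 2].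
  apply: (IH (fun k t => phi k (upd t d (g i))) (fun t => psi (upd t d (g i)))).
  - move=> k t t'; apply: le_trans (lphi _ _ _) _; rewrite big_ord_recr /=.
    rewrite {3 4}/upd eqxx subrr normr0 addr0 ler_wpM2l //.
    by apply: ler_sum => j _; rewrite /upd (ltn_eqF (ltn_ord j)).
  - move=> t t'; apply: le_trans (lpsi _ _) _; rewrite big_ord_recr /=.
    rewrite {3 4}/upd eqxx subrr normr0 addr0 ler_wpM2l //.
    by apply: ler_sum => j _; rewrite /upd (ltn_eqF (ltn_ord j)).
  - by move=> t e' e'0; exact: pw.
  - by rewrite divr_gt0.
apply: filterS (filter_forall UF H) => k /= hk t t1.
have td := t1 d; pose y := (t d + 1) * q.+1%:R.
have y0 : 0 <= y.
  by rewrite mulr_ge0 //; move: td; rewrite ler_norml => /andP[]; lra.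
have iy : (Num.truncn y < (2 * q.+1).+1)%N.
  rewrite ltnS truncn_le_nat.
  have : y <= (2 * q.+1)%:R.
    rewrite natrM /y ler_wpM2r //; move: td; rewrite ler_norml => /andP[]; lra.
  move=> h; apply: le_lt_trans h _; by rewrite ltr_nat.
have near_g : `|t d - g (Ordinal iy)| <= q.+1%:R^-1.
  have /andP[h1 h2] := truncn_itv y0.
  have q0 : 0 < q.+1%:R :> R by rewrite ltr0n.
  have -> : t d - g (Ordinal iy) = (y - (Num.truncn y)%:R) / q.+1%:R.
    by rewrite /g /y /=; field; rewrite addrC natr1 gt_eqF.
  rewrite normrM normfV (gtr0_norm q0) ler_piMl ?invr_ge0 ?ler0n //.
  rewrite ger0_norm ?subr_ge0 //; move: h2; rewrite -natr1; lra.
set t' := upd t d (g (Ordinal iy)).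
have lip : B * \sum_(j < d.+1) `|t j - t' j| <= e / 4.
  rewrite big_ord_recr /= big1 ?add0r.
    rewrite /t' /upd eqxx; apply: le_trans qB; exact: ler_wpM2l.
  by move=> j _; rewrite /t' /upd (ltn_eqF (ltn_ord j)) subrr normr0.
have h1 := le_trans (lphi k t t') lip.
have h2 := le_trans (lpsi t t') lip.
have h3 := hk (Ordinal iy) t t1; rewrite -/t' in h3.
have -> : phi k t - psi t = (phi k t - phi k t') + (phi k t' - psi t') - (psi t - psi t') by ring.
apply: le_trans (ler_normB _ _) _.
apply: le_trans (lerD (ler_normD _ _) (lexx _)) _.
lra.
Qed.

Lemma iter_ulim_scale (U : set_system nat) (x : nat -> V) (B t : R) :
  UltraFilter U -> (forall k, N (x k) <= B) -> forall n (a : nat -> R) v,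
  iter_ulim U x (mkseq (fun i => t * a i) n) (t *: v) =
  `|t| * iter_ulim U x (mkseq a n) v.
Proof.
move=> UU xB; have PU := ultra_proper.
elim=> [|n IH] a v; first by rewrite /= seminormZ.
have bnd (c : nat -> R) w k :
    `|iter_ulim U x (mkseq (fun i => c i.+1) n) (w + c 0%N *: x k)|
    <= N w + B * (`|c 0%N| + \sum_(i < n) `|c i.+1|).
  have [h _] := iter_ulim_lip UU xB n (fun i => c i.+1) c (w + c 0%N *: x k) w.
  apply: le_trans h _; rewrite mulrDr addrA lerD2r.
  apply: le_trans (seminormD _ _) _; rewrite lerD2l seminormZ mulrC.
  by rewrite ler_wpM2r.
rewrite !mkseqS_shift /=.
apply/eqP; rewrite -subr_eq0 -normr_le0; apply/ler_addgt0Pl => e e0; rewrite addr0.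
have e2 : 0 < e / 2 / (1 + `|t|) by rewrite !divr_gt0 // ltr_pwDl.
have [k /= []] := filter_ex (filterI
  (ulimP UU (bnd (fun i => t * a i) (t *: v)) e2) (ulimP UU (bnd a v) e2)).
set l1 := ulim _ _; set l2 := ulim _ _.
rewrite -scalerA -scalerDr IH; set z := iter_ulim _ _ _ _ => h1 h2.
have -> : l1 - `|t| * l2 = `|t| * (z - l2) - (`|t| * z - l1) by ring.
apply: le_trans (ler_normB _ _) _; rewrite normrM normr_id.
have h3 : `|t| * `|z - l2| <= `|t| * (e / 2 / (1 + `|t|)) by rewrite ler_wpM2l.
apply: le_trans (lerD h3 h1) _.
have -> : `|t| * (e / 2 / (1 + `|t|)) + e / 2 / (1 + `|t|) = e / 2.
  by field; rewrite gt_eqF // ltr_pwDl.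
lra.
Qed.

Lemma sum_extend (y : nat -> V) (c : nat -> R) (g : R) (t t' : nat) : (t < t')%N ->
  \sum_(j < t') (if (j < t)%N then c j else if j == t :> nat then g else 0) *: y j =
  \sum_(j < t) c j *: y j + g *: y t.
Proof.
move=> /subnK <-; elim: (t' - t.+1)%N => [|r IH]; last first.
  rewrite addSn big_ord_recr /= IH ifN; last by lia.
  by rewrite ifN ?scale0r ?addr0 //; apply/eqP; lia.
rewrite add0n big_ord_recr /= ltnn eqxx; congr (_ + _).
by apply: eq_bigr => j _; rewrite ltn_ord.
Qed.

(** Only finitely many [l] and, by [equilip_uniform], a compact set of coefficients matter, so one
    index [k] can replace the next limit for all of them at once. Zero entries of [th] cover the
    tuples that skip indices of [ms]. *)
Lemma iter_ulim_step (U : set_system nat) (x : nat -> V) (B : R) :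
  UltraFilter U -> \oo `<=` U -> (forall k, N (x k) <= B) ->
  forall (ms : seq nat) (e : R), 0 < e -> exists k,
  (forall j, j \in ms -> (j < k)%N) /\
  forall (l : nat) (th : nat -> R), (l <= size ms)%N -> (forall j, `|th j| <= 1) ->
  let t := size ms in
  let v := \sum_(j < t) th j *: x (nth 0%N ms j) in
  `|iter_ulim U x (mkseq (fun i => th (t.+1 + i)%N) l) (v + th t *: x k)
    - iter_ulim U x (mkseq (fun i => th (t + i)%N) l.+1) v| <= e.
Proof.
move=> UU oU xB ms e e0; have PU := ultra_proper.
have B0 : 0 <= B by exact: le_trans (seminorm_ge0 _) (xB 0%N).
pose t := size ms.
pose v (th : nat -> R) := \sum_(j < t) th j *: x (nth 0%N ms j).
pose phi l k (th : nat -> R) :=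
  iter_ulim U x (mkseq (fun i => th (t.+1 + i)%N) l) (v th + th t *: x k).
pose psi l (th : nat -> R) := iter_ulim U x (mkseq (fun i => th (t + i)%N) l.+1) (v th).
have vlip (th th' : nat -> R) : N (v th - v th') <= B * \sum_(j < t) `|th j - th' j|.
  rewrite /v -sumrB mulr_sumr; apply: le_trans (seminorm_sum _ _ _) _.
  apply: ler_sum => j _; rewrite -scalerBl seminormZ mulrC.
  by rewrite ler_wpM2r.
have H (l : 'I_t.+1) : U [set k | forall th, (forall j, `|th j| <= 1) ->
    `|phi l k th - psi l th| <= e].
  apply: (@equilip_uniform U _ B (t + l.+1)) => //.
  - move=> k th th'; rewrite /phi.
    have [_ h] := iter_ulim_lip UU xB l (fun i => th (t.+1 + i)%N)
      (fun i => th' (t.+1 + i)%N) (v th + th t *: x k) (v th' + th' t *: x k).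
    apply: le_trans h _; rewrite big_split_ord /= big_ord_recl /= addn0.
    rewrite opprD addrACA -scalerBl !mulrDr addrA lerD //.
      apply: le_trans (seminormD _ _) _; rewrite lerD // seminormZ mulrC.
      by rewrite ler_wpM2r.
    by rewrite ler_wpM2l // ler_sum // => j _; rewrite /bump /= add1n addSnnS.
  - move=> th th'; rewrite /psi.
    have [_ h] := iter_ulim_lip UU xB l.+1 (fun i => th (t + i)%N)
      (fun i => th' (t + i)%N) (v th) (v th').
    apply: le_trans h _; rewrite big_split_ord /= mulrDr lerD //.
  - move=> th e' e'0; rewrite /psi mkseqS_shift /= addn0 /phi.
    under [X in iter_ulim _ _ (mkseq X _)]eq_fun do rewrite addSnnS.
    apply: (@ulimP R U _ (N (v th) + B * (`|th t| + \sum_(i < l) `|th (t + i.+1)%N|))) => // k.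
    have [h _] := iter_ulim_lip UU xB l (fun i => th (t + i.+1)%N) th (v th + th t *: x k) 0.
    apply: le_trans h _; rewrite mulrDr addrA lerD2r.
    apply: le_trans (seminormD _ _) _; rewrite lerD2l seminormZ mulrC.
    by rewrite ler_wpM2r.
have big : U [set k | forall j, j \in ms -> (j < k)%N].
  apply: oU; have := nbhs_infty_ge (\max_(j <- ms) j).+1.
  apply: filterS => k /= hk j jm; apply: leq_trans hk; rewrite ltnS.
  exact: (@leq_bigmax_seq _ ms xpredT id j jm isT).
have [k /= [k1 k2]] := filter_ex (filterI big (filter_forall ultra_proper H)).
exists k; split=> // l th lt h1.
exact: (k2 (Ordinal (lt : (l < t.+1)%N)) th h1).
Qed.

Theorem brunel_sucheston (x : nat -> V) (B : R) : (forall k, N (x k) <= B) ->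
  exists m E, (forall i, (m i < m i.+1)%N) /\ asym (x \o m) E.
Proof.
move=> xB; have [U [UU oU]] := @ultraFilterLemma nat \oo _.
(* The square is needed because a tuple starting at [k 0] has up to [(k 0).+1] entries, each
   replaced at cost at most [dl (k 0)], and the total has to stay below [1 / (k 0).+1]. *)
pose dl t : R := (t.+1%:R ^+ 2)^-1.
have dl0 t : 0 < dl t by rewrite invr_gt0 exprn_gt0.
have [step stepP] := choice (fun ms => iter_ulim_step UU oU xB ms (dl0 (size ms))).
pose hist := fix h t := if t is t'.+1 then rcons (h t') (step (h t')) else [::].
pose m t := step (hist t).
have histE t : hist t = mkseq m t.
  by elim: t => // t IH; rewrite /= -/(m t) IH -[t.+1]addn1 /mkseq iotaD map_cat cats1.
have szh t : size (hist t) = t by rewrite histE size_mkseq.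
exists m, (fun n a => iter_ulim U x (mkseq a n) 0); split=> [i|].
  apply: (proj1 (stepP (hist i.+1))) => //.
  by rewrite /= -/(m i) mem_rcons inE eqxx.
have stepQ t l (th : nat -> R) : (l <= t)%N -> (forall j, `|th j| <= 1) ->
    let v := \sum_(j < t) th j *: x (m j) in
    `|iter_ulim U x (mkseq (fun i => th (t.+1 + i)%N) l) (v + th t *: x (m t))
      - iter_ulim U x (mkseq (fun i => th (t + i)%N) l.+1) v| <= dl t.
  move=> lt th1; have [_ /(_ l th)] := stepP (hist t); rewrite szh => /(_ lt th1) /=.
  rewrite -/(m t); under eq_bigr do rewrite histE nth_mkseq //.
  by [].
have main n (a : nat -> R) (k : nat -> nat) : (forall i, (i < n)%N -> `|a i| <= 1) ->
    (forall i, (i.+1 < n)%N -> (k i < k i.+1)%N) -> (n <= (k 0%N).+1)%N ->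
    `|N (\sum_(i < n) a i *: x (m (k i))) - iter_ulim U x (mkseq a n) 0|
      <= (k 0%N).+1%:R^-1.
  move=> a1 kinc nk.
  have kge i : (i < n)%N -> (k 0%N <= k i)%N.
    elim: i => // i IH ilt; apply: leq_trans (IH (ltnW ilt)) _.
    exact: ltnW (kinc _ ilt).
  have rep i : (i < n)%N -> exists c : nat -> R, (forall j, `|c j| <= 1) /\
      \sum_(j < i) a j *: x (m (k j)) = \sum_(j < k i) c j *: x (m j).
    elim: i => [|i IH] ilt.
      exists (fun=> 0); split=> [j|]; first by rewrite normr0.
      by rewrite big_ord0 big1 // => j _; rewrite scale0r.
    have [c [c1 cE]] := IH (ltnW ilt).
    exists (fun j => if (j < k i)%N then c j else if j == k i then a i else 0).
    split=> [j|].
      by case: ifP => // _; case: ifP => _; rewrite ?normr0 // a1 // ltnW.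
    by rewrite big_ord_recr /= cE (@sum_extend (fun j => x (m j))) // kinc.
  (* [T i] has its first [i] vectors in place and [n - i] limits still to be taken; it interpolates
     between the iterated limit [T 0] and the actual norm [T n]. *)
  pose T i := iter_ulim U x (mkseq (fun j => a (i + j)%N) (n - i))
                (\sum_(j < i) a j *: x (m (k j))).
  have tele i : (i <= n)%N -> `|T i - T 0%N| <= i%:R * dl (k 0%N).
    elim: i => [|i IH] ilt; first by rewrite subrr normr0 mul0r.
    have -> : T i.+1 - T 0%N = (T i.+1 - T i) + (T i - T 0%N) by ring.
    apply: le_trans (ler_normD _ _) _.
    rewrite -natr1 mulrDl mul1r addrC lerD ?IH //; first exact: ltnW.
    have [c [c1 cE]] := rep i ilt.
    (* Coefficients on the full history: the tuple chosen so far, padded by zeros, below [k i], then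
       [a i, a i.+1, ...] from position [k i] on. *)
    pose th j := if (j < k i)%N then c j else
      if (i + (j - k i) < n)%N then a (i + (j - k i))%N else 0.
    have th1 j : `|th j| <= 1.
      rewrite /th; case: ifP => // _; case: ifP => h; first exact: a1.
      by rewrite normr0.
    have := @stepQ (k i) (n - i.+1)%N th _ th1.
    have -> : \sum_(j < k i) th j *: x (m j) = \sum_(j < i) a j *: x (m (k j)).
      by rewrite cE; apply: eq_bigr => j _; rewrite /th ltn_ord.
    have -> : th (k i) = a i by rewrite /th ltnn subnn addn0 ilt.
    have -> : mkseq (fun j => th ((k i).+1 + j)%N) (n - i.+1) =
              mkseq (fun j => a (i.+1 + j)%N) (n - i.+1).
      apply/eq_in_map => j; rewrite mem_iota /= add0n => jlt.
      rewrite /th ifN; last by lia.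
      have -> : (i + ((k i).+1 + j - k i) = i.+1 + j)%N by lia.
      by rewrite ifT //; lia.
    have -> : mkseq (fun j => th (k i + j)%N) (n - i.+1).+1 =
              mkseq (fun j => a (i + j)%N) (n - i).
      rewrite subnSK //; apply/eq_in_map => j; rewrite mem_iota /= add0n => jlt.
      rewrite /th ifN; last by lia.
      have -> : (i + (k i + j - k i) = i + j)%N by lia.
      by rewrite ifT //; lia.
    move=> h; apply: le_trans (_ : _ <= dl (k i)) _.
      rewrite /T big_ord_recr /=; apply: h.
      by have := kge i ilt; lia.
    rewrite /dl lef_pV2 ?posrE ?exprn_gt0 //.
    by rewrite lerXn2r ?nnegrE ?ler0n // ler_nat ltnS kge.
  have := tele n (leqnn n); rewrite {1}/T subnn /= {1}/T big_ord0 subn0 => h.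
  apply: le_trans h _; rewrite /dl exprS expr1 invfM mulrA.
  by rewrite ler_piMl ?invr_ge0 ?ler0n // ler_pdivrMr ?ltr0n // mul1r ler_nat.
move=> n a k M M1 aM kinc nk /=.
have [M0|M0] := ltP 0 M; last first.
  have a0 i : (i < n)%N -> a i = 0.
    by move=> /aM h; apply/eqP; rewrite -normr_le0; exact: le_trans M0.
  have -> : M = 0 by apply/eqP; rewrite eq_le M0.
  rewrite big1 ?seminorm0 ?mul0r; last by move=> i _; rewrite a0 // scale0r.
  have -> : mkseq a n = mkseq (fun i => 0 * a i) n.
    by apply/eq_in_map => i; rewrite mem_iota /= => /a0 ->; rewrite mulr0.
  rewrite -[X in iter_ulim _ _ _ X](scale0r (0 : V)) (iter_ulim_scale _ UU xB).
  by rewrite normr0 mul0r subr0 normr0.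
have := main n (fun i => M^-1 * a i) k.
have -> : \sum_(i < n) (M^-1 * a i) *: x (m (k i)) =
          M^-1 *: \sum_(i < n) a i *: x (m (k i)).
  by rewrite scaler_sumr; apply: eq_bigr => i _; rewrite scalerA.
rewrite -[X in iter_ulim _ _ _ X](scaler0 _ M^-1) (iter_ulim_scale _ UU xB) seminormZ.
rewrite -mulrBr normrM normr_id (gtr0_norm (_ : 0 < M^-1)) ?invr_gt0 //.
rewrite ler_pdivrMl //; apply=> // i ilt.
by rewrite normrM gtr0_norm ?invr_gt0 // ler_pdivrMl // mulr1 aM.
Qed.

End seminorm.

(** * Norms of spreading models *)

Definition incr_on (n : nat) (k : nat -> nat) : Prop :=
  forall i, (i.+1 < n)%N -> (k i < k i.+1)%N.

Lemma incr_on_shift n K : incr_on n (addn K).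
Proof. by move=> i _; rewrite addnS. Qed.

Section asym.
Variables (R : realType) (V : lmodType R) (N : V -> R).

(** Uniformity over coefficient vectors matters when the coefficients depend on the positions, as
    they do through normalizing factors. *)
Lemma asym_eps_unif x E n (M e : R) : asym N x E -> 0 <= M -> 0 < e ->
  exists K0, forall a k, (forall i, (i < n)%N -> `|a i| <= M) -> incr_on n k ->
  (K0 <= k 0%N)%N -> `|N (\sum_(i < n) a i *: x (k i)) - E n a| <= e.
Proof.
move=> xE M0 e0; exists (n + Num.truncn (M / e))%N => a k aM kinc Kk.
apply: le_trans (xE n a k M M0 aM kinc _) _; first by lia.
rewrite ler_pdivrMr ?ltr0n // mulrC -ler_pdivrMr //.
apply: ltW; apply: lt_le_trans (truncnS_gt _) _.
by rewrite ler_nat ltnS (leq_trans (leq_addl _ _) Kk).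
Qed.

Lemma asym_eps x E n (a : nat -> R) (e : R) : asym N x E -> 0 < e ->
  exists K0, forall k, incr_on n k -> (K0 <= k 0%N)%N ->
  `|N (\sum_(i < n) a i *: x (k i)) - E n a| <= e.
Proof.
move=> xE e0.
have M0 : 0 <= \sum_(i < n) `|a i| by exact: sumr_ge0.
have [K0 HK] := asym_eps_unif n xE M0 e0.
exists K0 => k; apply: HK => i ilt.
by rewrite (bigD1 (Ordinal ilt)) //= lerDl sumr_ge0.
Qed.

Lemma asym_ge x E n (a : nat -> R) (c : R) K1 : asym N x E ->
  (forall k, incr_on n k -> (K1 <= k 0%N)%N ->
     c <= N (\sum_(i < n) a i *: x (k i))) -> c <= E n a.
Proof.
move=> xE h; apply/ler_addgt0Pr => e e0.
have [K0 HK] := asym_eps n a xE e0.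
pose k := addn (K0 + K1)%N.
have := HK k (@incr_on_shift _ _); rewrite /k addn0 leq_addr => /(_ isT).
have := h k (@incr_on_shift _ _); rewrite /k addn0 leq_addl => /(_ isT).
rewrite ler_distl => h1 /andP[h2 h3]; lra.
Qed.

Lemma asym_sub x E m : asym N x E -> (forall i, (m i < m i.+1)%N) -> asym N (x \o m) E.
Proof.
move=> xE minc n a k M M0 aM kinc nk.
have mi i j : (i < j)%N -> (m i < m j)%N.
  move=> /subnK <-; elim: (j - i.+1)%N => [|d IH]; first exact: minc.
  by rewrite addSn; exact: ltn_trans IH (minc _).
have mge i : (i <= m i)%N by elim: i => // i IH; exact: leq_ltn_trans IH (minc i).
have h := xE n a (m \o k) M M0 aM _ _.
apply: le_trans (h _ _) _.
- by move=> i ilt /=; exact/mi/kinc.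
- by apply: leq_trans nk _; rewrite ltnS /= mge.
- by rewrite /= ler_wpM2l // lef_pV2 ?posrE ?ltr0n // ler_nat ltnS mge.
Qed.

End asym.

(** Both sides converge along any increasing indices far out, so an inequality known only for such
    positions survives in the limit, even between different norms, lengths and index patterns. *)
Lemma asym_le (R : realType) (V V' : lmodType R) (N : V -> R) (N' : V' -> R)
    x E x' E' n n' (a b : nat -> R) (c : R) (k k' : nat -> nat -> nat) K1 :
  asym N x E -> asym N' x' E' -> 0 <= c ->
  (forall K, (K1 <= K)%N -> [/\ incr_on n (k K), incr_on n' (k' K),
      (K <= k K 0%N)%N, (K <= k' K 0%N)%N &
      N (\sum_(i < n) a i *: x (k K i)) <= c * N' (\sum_(i < n') b i *: x' (k' K i))]) ->
  E n a <= c * E' n' b.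
Proof.
move=> xE xE' c0 h; apply/ler_addgt0Pr => e e0.
have e2 : 0 < e / (1 + c) by rewrite divr_gt0 // ltr_pwDl.
have [K0 HK] := asym_eps n a xE e2.
have [K0' HK'] := asym_eps n' b xE' e2.
have [i1 i2 k1 k2 le] := h (K0 + K0' + K1)%N (leq_addl _ _).
have := HK _ i1 (leq_trans _ k1); have := HK' _ i2 (leq_trans _ k2).
set z := N _ in le *; set z' := N' _ in le *.
rewrite !ler_distl => /(_ _)/andP[|_ h1]; first by lia.
move=> /(_ _)/andP[|h2 _]; first by lia.
have h3 : c * z' <= c * (E' n' b + e / (1 + c)).
  by rewrite ler_wpM2l //; lra.
have -> : e = e / (1 + c) + c * (e / (1 + c)).
  by field; rewrite gt_eqF // ltr_pwDl.
move: h3; rewrite mulrDr; lra.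
Qed.

Section asym_seminorm.
Variables (R : realType) (V : lmodType R) (N : V -> R).
Hypothesis sN : seminorm N.
Variables (x : nat -> V) (E : nat -> (nat -> R) -> R).
Hypothesis xE : asym N x E.

Lemma asym_ext n (a b : nat -> R) :
  (forall i, (i < n)%N -> a i = b i) -> E n a = E n b.
Proof.
have H (a' b' : nat -> R) : (forall i, (i < n)%N -> a' i = b' i) -> E n a' <= E n b'.
  move=> ab; rewrite -[E n b']mul1r.
  apply: (asym_le (k := addn) (k' := addn) (K1 := 0%N) xE xE) => // K _.
  rewrite addn0 mul1r; split=> //; try exact: incr_on_shift.
  by rewrite (eq_bigr (fun i : 'I_n => b' i *: x (K + i)%N)) // => i _; rewrite ab.
by move=> ab; apply/eqP; rewrite eq_le !H // => i ilt; rewrite ab.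
Qed.

Lemma asymD n (a b : nat -> R) : E n (fun i => a i + b i) <= E n a + E n b.
Proof.
apply/ler_addgt0Pr => e e0.
have e3 : 0 < e / 3 by rewrite divr_gt0.
have [K1 H1] := asym_eps n a xE e3.
have [K2 H2] := asym_eps n b xE e3.
have [K3 H3] := asym_eps n (fun i => a i + b i) xE e3.
pose k := addn (K1 + K2 + K3)%N.
have := H1 k (@incr_on_shift _ _); have := H2 k (@incr_on_shift _ _).
have := H3 k (@incr_on_shift _ _); rewrite /k addn0.
rewrite !ler_distl => /(_ _)/andP[|h1 _]; first by lia.
move=> /(_ _)/andP[|_ h2]; first by lia.
move=> /(_ _)/andP[|_ h3]; first by lia.
have : N (\sum_(i < n) (a i + b i) *: x (K1 + K2 + K3 + i)%N) <=
  N (\sum_(i < n) a i *: x (K1 + K2 + K3 + i)%N) + N (\sum_(i < n) b i *: x (K1 + K2 + K3 + i)%N).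
  apply: le_trans (seminormD sN _ _); rewrite -big_split /=.
  by under eq_bigr do rewrite scalerDl.
lra.
Qed.

Lemma asymZ n (t : R) (a : nat -> R) : E n (fun i => t * a i) = `|t| * E n a.
Proof.
have H s (b : nat -> R) : E n (fun i => s * b i) <= `|s| * E n b.
  apply: (asym_le (k := addn) (k' := addn) (K1 := 0%N) xE xE) => // K _.
  rewrite addn0; split=> //; try exact: incr_on_shift.
  by rewrite -seminormZ // scaler_sumr; under eq_bigr do rewrite -scalerA.
apply/eqP; rewrite eq_le H /=.
have [->|t0] := eqVneq t 0.
  rewrite normr0 mul0r; apply: (asym_ge (K1 := 0%N) xE) => k _ _.
  exact: seminorm_ge0.
rewrite -ler_pdivlMl ?normr_gt0 // -normfV.
apply: le_trans (H _ _); rewrite (@asym_ext n a (fun i => t^-1 * (t * a i))) //.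
by move=> i _; rewrite mulKf.
Qed.

Lemma asym_ge0 n (a : nat -> R) : 0 <= E n a.
Proof. by apply: (asym_ge (K1 := 0%N) xE) => k _ _; exact: seminorm_ge0. Qed.

Lemma asym0 n (a : nat -> R) : (forall i, (i < n)%N -> a i = 0) -> E n a = 0.
Proof.
move=> a0; rewrite (@asym_ext n a (fun i => 0 * a i)) ?asymZ ?normr0 ?mul0r //.
by move=> i /a0 ->; rewrite mulr0.
Qed.

(** Coefficients that vanish may be deleted: this is where spreading is used. *)
Lemma asym_spread n r (a : nat -> R) (q : nat -> nat) :
  incr_on r q -> (forall j, (j < r)%N -> (q j < n)%N) ->
  (forall i, (i < n)%N -> a i != 0 -> exists2 j, (j < r)%N & i = q j) ->
  E n a = E r (a \o q).
Proof.
move=> qinc qn aq.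
have qmono i j : (i < j)%N -> (j < r)%N -> (q i < q j)%N.
  elim: j => // j IH; rewrite ltnS leq_eqVlt => /orP[/eqP<- jr|ij jr].
    exact: qinc.
  by apply: ltn_trans (IH ij (ltnW jr)) _; exact: qinc.
have qinj (i j : 'I_r) : q i = q j -> i = j.
  move=> qij; apply/val_inj/eqP; case: ltngtP => //= ij.
    by have := qmono _ _ ij (ltn_ord j); rewrite qij ltnn.
  by have := qmono _ _ ij (ltn_ord i); rewrite qij ltnn.
have sumE K : \sum_(i < n) a i *: x (K + i)%N = \sum_(j < r) (a \o q) j *: x (K + q j)%N.
  transitivity (\sum_(i < n) \sum_(j < r | q j == i) a i *: x (K + i)%N).
    apply: eq_bigr => i _; have [ai0|/(aq i (ltn_ord i))[j jr ij]] := eqVneq (a i) 0.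
      by rewrite ai0 scale0r big1.
    rewrite (big_pred1 (Ordinal jr)) // => j' /=; apply/eqP/eqP => [h|-> //].
    by apply: qinj; rewrite h.
  rewrite (exchange_big_dep xpredT) //=; apply: eq_bigr => j _.
  by rewrite (big_pred1 (Ordinal (qn j (ltn_ord j)))).
apply/eqP; rewrite eq_le -[X in _ <= X]mul1r -[X in _ && (_ <= X)]mul1r.
have inc K : incr_on r (fun j => K + q j)%N by move=> i ir; rewrite ltn_add2l qinc.
apply/andP; split.
  apply: (asym_le (k := addn) (k' := fun K j => (K + q j)%N) (K1 := 0%N) xE xE) => // K _.
  by rewrite sumE mul1r addn0 leq_addr; split=> //; exact: incr_on_shift.
apply: (asym_le (k' := addn) (k := fun K j => (K + q j)%N) (K1 := 0%N) xE xE) => // K _.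
by rewrite sumE mul1r addn0 leq_addr; split=> //; exact: incr_on_shift.
Qed.

Lemma asym_pad n n' (a : nat -> R) : (n <= n')%N ->
  (forall i, (n <= i < n')%N -> a i = 0) -> E n' a = E n a.
Proof.
move=> nn a0; rewrite (@asym_spread n' n a id) //.
  by move=> j jn; exact: leq_trans nn.
move=> i ilt ai; exists i => //; rewrite ltnNge; apply/negP => ni.
by move: ai; rewrite a0 ?ni ?eqxx.
Qed.

End asym_seminorm.

Lemma asym_indicator (R : realType) (V : lmodType R) (N : V -> R) x E n (P : pred nat) :
  asym N x E -> E n (fun i => (P i)%:R) = E (count P (iota 0 n)) (fun=> 1).
Proof.
move=> xE; set s := [seq i <- iota 0 n | P i].
have szs : size s = count P (iota 0 n) by rewrite size_filter.
have inS j : (j < size s)%N -> P (nth 0%N s j) /\ (nth 0%N s j < n)%N.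
  by move=> /(mem_nth 0%N); rewrite mem_filter mem_iota add0n => /andP[].
rewrite -szs (asym_spread xE (r := size s) (q := nth 0%N s)).
- by apply: (asym_ext xE) => j /inS[Pj _] /=; rewrite Pj.
- move=> i ilt; apply: (sorted_ltn_nth ltn_trans) => //; rewrite ?inE //; last exact: ltnW.
  by rewrite (sorted_filter ltn_trans) // iota_ltn_sorted.
- by move=> j /inS[].
move=> i ilt /=; have [Pi _|_] := boolP (P i); last by rewrite eqxx.
have iS : i \in s by rewrite mem_filter Pi mem_iota add0n.
by exists (index i s); rewrite ?index_mem ?nth_index.
Qed.

(** * Realizing a limit norm as a spreading model *)

Record poly_norm (R : realType) := PolyNorm {
  pnorm :> {poly R} -> R;
  pnormD : forall p q, pnorm (p + q) <= pnorm p + pnorm q;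
  pnormZ : forall (c : R) p, pnorm (c *: p) = `|c| * pnorm p;
  pnorm0_eq0 : forall p, pnorm p = 0 -> p = 0 }.

(** Polynomials model finitely supported sequences, with ['X^i] as the [i]-th unit vector; the alias
    attaches a chosen norm to this common module. *)
Definition normed_poly (R : realType) (nu : poly_norm R) : Type := {poly R}.
HB.instance Definition _ (R : realType) (nu : poly_norm R) :=
  GRing.Lmodule.on (normed_poly nu).
HB.instance Definition _ (R : realType) (nu : poly_norm R) :=
  Lmodule_isNormed.Build R (normed_poly nu) (pnormD nu) (pnormZ nu) (@pnorm0_eq0 _ nu).

(** The lower bound on coefficients makes [E] definite, hence a norm, and turns the additive error
    of [asym] into a relative one, since coefficients are at most [1 / c] times the norm. *)
Theorem asym_generates (R : realType) (V : lmodType R) (N : V -> R) x E (c : R) :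
  seminorm N -> asym N x E -> 0 < c ->
  (forall n (a : nat -> R) k j, incr_on n k -> (j < n)%N ->
     c * `|a j| <= N (\sum_(i < n) a i *: x (k i))) ->
  exists (W : normedModType R) (xt : nat -> W),
    (forall n a, comb_norm xt n a = E n a) /\ generates_spreading_model N x xt.
Proof.
move=> sN xE c0 low.
have lowE n (a : nat -> R) j : (j < n)%N -> c * `|a j| <= E n a.
  by move=> jn; apply: (asym_ge (K1 := 0%N) xE) => k kinc _; exact: low.
pose nrm (p : {poly R}) := E (size p) (fun i => p`_i).
have nrmE n (p : {poly R}) : (size p <= n)%N -> nrm p = E n (fun i => p`_i).
  move=> pn; rewrite [RHS](asym_pad xE pn) // => i /andP[h _].
  by rewrite nth_default.
have nD p q : nrm (p + q) <= nrm p + nrm q.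
  pose n := maxn (size p) (size q).
  rewrite (@nrmE n (p + q)) ?size_polyD // (@nrmE n p) ?leq_maxl // (@nrmE n q) ?leq_maxr //.
  apply: le_trans (asymD sN xE n (fun i => p`_i) (fun i => q`_i)).
  by rewrite (asym_ext xE (b := fun i => p`_i + q`_i)) // => i _; rewrite coefD.
have nZ (t : R) p : nrm (t *: p) = `|t| * nrm p.
  rewrite (@nrmE (size p) (t *: p)) ?size_scale_leq // /nrm -(asymZ sN xE).
  by apply: (asym_ext xE) => i _; rewrite coefZ.
have n0 p : nrm p = 0 -> p = 0.
  move=> p0; apply/polyP => j; rewrite coef0.
  have [h|h] := leqP (size p) j; first by rewrite nth_default.
  have := lowE (size p) (fun i => p`_i) j h; rewrite -/(nrm p) p0 pmulr_rle0 //.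
  by rewrite normr_le0 => /eqP.
pose W : normedModType R := normed_poly (PolyNorm nD nZ n0).
pose xt (i : nat) : W := ('X^i : {poly R}).
have xtE n a : comb_norm xt n a = E n a.
  rewrite /comb_norm.
  have -> : \sum_(i < n) a i *: xt i = \poly_(i < n) a i :> {poly R} by rewrite poly_def.
  rewrite [LHS](@nrmE n) ?size_poly //.
  by apply: (asym_ext xE) => i ilt; rewrite coef_poly ilt.
exists W, xt; split=> //.
have c2 : 0 <= 2 / c by rewrite divr_ge0 // ltW.
(* The factor 2 absorbs an index shift: [harmonic n] is [1 / n.+1], while the available rate is
   [1 / (k 0).+1] with only [n <= (k 0).+1]. *)
exists (fun n => 2 / c * harmonic n); split; [|split].
- move=> m n mn; rewrite ler_wpM2l // /harmonic /=.
  by rewrite lef_pV2 ?posrE ?ltr0n // ler_nat.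
- rewrite -[X in _ --> X](mulr0 (2 / c)).
  by apply: cvgMr; exact: cvg_harmonic.
move=> n a k _ kinc nk; rewrite -/(comb_norm xt n a) xtE.
set z := N _; have z0 : 0 <= z by exact: seminorm_ge0.
have E0 : 0 <= E n a by exact: (asym_ge0 sN xE).
have e0 : 0 <= 2 / c * harmonic n by rewrite mulr_ge0 ?harmonic_ge0.
have bnd (M : R) : 0 <= M -> (forall i, (i < n)%N -> c * `|a i| <= M) ->
    `|z - E n a| <= M * (2 / c * harmonic n).
  move=> M0 aM; have Mc : 0 <= M / c by rewrite divr_ge0 // ltW.
  have := xE n a k (M / c) Mc _ kinc nk; rewrite -/z => h.
  apply: le_trans (h _) _.
    by move=> i ilt; rewrite ler_pdivlMr // mulrC aM.
  have -> : M * (2 / c * harmonic n) = M / c * (2 * harmonic n) by ring.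
  rewrite ler_wpM2l //= ler_pdivlMr ?ltr0n // mulrC ler_pdivrMr ?ltr0n //.
  rewrite -natrM ler_nat; lia.
split.
  rewrite ler_pdivrMl ?ltr_pwDl // mulrDl mul1r [X in _ <= _ + X]mulrC.
  have := bnd z z0 (fun i ilt => low n a k i kinc ilt).
  by rewrite distrC ler_distl => /andP[_].
rewrite mulrDl mul1r [X in _ <= _ + X]mulrC.
have := bnd (E n a) E0 (fun i ilt => lowE n a i ilt).
by rewrite ler_distl => /andP[_].
Qed.

(** * Unconditionality and tensor products of coefficient sequences *)

(** The entry [(i, j)] sits at position [i * l + j]. *)
Definition tens (R : realType) (l : nat) (a b : nat -> R) (i : nat) : R :=
  a (i %/ l)%N * b (i %% l)%N.

Lemma sum_divmod (V : zmodType) n l (G : nat -> nat -> V) : (0 < l)%N ->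
  \sum_(i < n * l) G (i %/ l)%N (i %% l)%N = \sum_(i < n) \sum_(r < l) G i r.
Proof.
move=> l0; elim: n => [|n IH]; first by rewrite mul0n !big_ord0.
rewrite mulSnr big_split_ord /= IH big_ord_recr /=; congr (_ + _).
apply: eq_bigr => r _; rewrite divnMDl // modnMDl divn_small // modn_small //.
by rewrite addn0.
Qed.

Lemma divmod_lt n l i : (i < n * l)%N -> (i %/ l < n)%N /\ (i %% l < l)%N.
Proof.
move=> h; have l0 : (0 < l)%N by case: l h => //; rewrite muln0.
by rewrite ltn_divLR // ltn_mod.
Qed.

Section unconditional.
Variables (R : realType) (E : nat -> (nat -> R) -> R) (C : R).
Hypothesis Eext : forall n a b, (forall i, (i < n)%N -> a i = b i) -> E n a = E n b.
Hypothesis ED : forall n a b, E n (fun i => a i + b i) <= E n a + E n b.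
Hypothesis EZ : forall n t a, E n (fun i => t * a i) = `|t| * E n a.
Hypothesis Esup : forall n (P : pred nat) a,
  E n (fun i => if P i then a i else 0) <= C * E n a.

(** The norm of the product is convex in each [th j] separately, so it is bounded by its values at
    [th j = 0] and [th j = 1]; once all coordinates are extreme, [Esup] applies. The induction is on
    the number [j] of leading coordinates that may be fractional. *)
Lemma multiplier01 n (th a : nat -> R) : (forall i, 0 <= th i <= 1) ->
  E n (fun i => th i * a i) <= C * E n a.
Proof.
suff H j : forall th, (forall i, 0 <= th i <= 1) ->
    (forall i, (j <= i < n)%N -> th i = 0 \/ th i = 1) ->
    E n (fun i => th i * a i) <= C * E n a.
  by move=> h; apply: (H n) => // i; rewrite ltnNge andbN.
elim: j => [|j IH] {}th th01 thj.
  apply: le_trans (Esup n (fun i => th i == 1) a).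
  rewrite (@Eext n _ (fun i => if th i == 1 then a i else 0)) // => i ilt.
  have [->|->] := thj i ilt; first by rewrite mul0r eq_sym oner_eq0.
  by rewrite eqxx mul1r.
have up (g : R) : g = 0 \/ g = 1 -> E n (fun i => upd th j g i * a i) <= C * E n a.
  move=> g01; apply: IH => i; rewrite /upd.
    by case: ifP => // _; case: g01 => ->; rewrite lexx ler01.
  move=> /andP[ji ilt]; case: eqP => // /eqP ij; apply: thj.
  by rewrite ilt andbT ltn_neqAle ji eq_sym ij.
have -> : E n (fun i => th i * a i) =
  E n (fun i => th j * (upd th j 1 i * a i) + (1 - th j) * (upd th j 0 i * a i)).
  by apply: Eext => i _; rewrite /upd; case: eqP => [->|_]; ring.
apply: le_trans (ED _ _ _) _; rewrite !EZ.
have /andP[h0 h1] := th01 j.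
rewrite (ger0_norm h0) (ger0_norm (_ : 0 <= 1 - th j)) ?subr_ge0 //.
have -> : C * E n a = th j * (C * E n a) + (1 - th j) * (C * E n a) by ring.
apply: lerD; apply: ler_wpM2l; rewrite ?subr_ge0 //; apply: up; [by right|by left].
Qed.

(** Write [a = rho b] with [|rho| <= 1]. The positive and negative parts of [rho] are multipliers
    with values in [[0, 1]], hence the factor 2. *)
Lemma lattice_le n (a b : nat -> R) : (forall i, (i < n)%N -> `|a i| <= `|b i|) ->
  E n a <= 2 * C * E n b.
Proof.
move=> ab; pose rho i := if (i < n)%N then a i / b i else 0.
have aE i : (i < n)%N -> a i = rho i * b i.
  move=> ilt; rewrite /rho ilt; have [b0|b0] := eqVneq (b i) 0; last by rewrite divfK.
  by rewrite b0 mulr0; apply/eqP; have := ab i ilt; rewrite b0 normr0 normr_le0.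
have rho1 i : -1 <= rho i <= 1.
  rewrite -ler_norml /rho; case: ifP => [ilt|_]; last by rewrite normr0.
  have [b0|b0] := eqVneq (b i) 0; first by rewrite b0 invr0 mulr0 normr0.
  by rewrite normrM normfV ler_pdivrMr ?normr_gt0 // mul1r ab.
pose tp i := Num.max (rho i) 0; pose tm i := Num.max (- rho i) 0.
have -> : E n a = E n (fun i => tp i * b i + -1 * (tm i * b i)).
  apply: Eext => i ilt; rewrite aE // /tp /tm !maxEle.
  by case: ifP => h1; case: ifP => h2; [have ->: rho i = 0 by lra| | |]; try ring; lra.
apply: le_trans (ED _ _ _) _; rewrite EZ normrN1 mul1r -mulrA mulr_natl mulr2n.
apply: lerD; apply: multiplier01 => i; have /andP[h1 h2] := rho1 i;
  by rewrite /tp /tm maxEle; case: ifP => h; rewrite ?lexx ?ler01 //; lra.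
Qed.

End unconditional.

(** * Uniform domination of identically distributed blocks *)

Definition restr (R : realType) (F : seq nat) (p : {poly R}) : {poly R} :=
  \poly_(i < size p) (if i \in F then p`_i else 0).

(** Coefficientwise stand-in for weak nullity: [weak_null_basis] and [weak_null_dual] show that,
    after normalization, such sequences are weakly null in [X] and in its dual. The gluing argument
    can thus be done once for both norms. *)
Definition vanishing (R : realType) (x : nat -> {poly R}) : Prop :=
  forall i, exists K0, forall k, (K0 <= k)%N -> (x k)`_i = 0.

Section restr.
Variable R : realType.

Lemma coef_restr F (p : {poly R}) i : (restr F p)`_i = if i \in F then p`_i else 0.
Proof.
rewrite coef_poly; case: ltnP => // h; rewrite nth_default //.
by case: ifP.
Qed.

Lemma restr_sum (I : Type) (r : seq I) (P : pred I) F (p : I -> {poly R}) :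
  restr F (\sum_(i <- r | P i) p i) = \sum_(i <- r | P i) restr F (p i).
Proof.
apply/polyP => i; rewrite coef_restr !coef_sum.
case: ifP => h; first by apply: eq_bigr => j _; rewrite coef_restr h.
by rewrite big1 // => j _; rewrite coef_restr h.
Qed.

Lemma restrZ F (c : R) (p : {poly R}) : restr F (c *: p) = c *: restr F p.
Proof. by apply/polyP => i; rewrite !(coefZ, coef_restr); case: ifP; rewrite ?mulr0. Qed.

Lemma restrX F j : restr F ('X^j : {poly R}) = if j \in F then 'X^j else 0.
Proof.
apply/polyP => i; rewrite coef_restr; case: (eqVneq i j) => [->|ij].
  by case: ifP; rewrite ?coef0.
by rewrite !coefXn (negPf ij) !if_same; case: ifP; rewrite ?coef0 ?coefXn ?(negPf ij).
Qed.

End restr.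

(** * Schreier unconditional norms on finitely supported sequences *)

Section schreier.
Variables (R : realType) (M : {poly R} -> R) (C : R).
Hypothesis sM : seminorm M.
Hypothesis SU : forall F p, schreier1 F -> M (restr F p) <= C * M p.
Hypothesis MX : forall i, M 'X^i = 1.

Lemma schreier_single i : schreier1 [:: i].
Proof. by split=> // j; rewrite inE => /eqP->. Qed.

Lemma coef_bound (p : {poly R}) i : `|p`_i| <= C * M p.
Proof.
apply: le_trans (SU p (schreier_single i)).
have -> : restr [:: i] p = p`_i *: 'X^i.
  apply/polyP => j; rewrite coef_restr coefZ coefXn inE.
  by case: eqP => [->|_]; rewrite ?mulr1 ?mulr0.
by rewrite seminormZ // MX mulr1.
Qed.

Lemma schreier_ge1 : 1 <= C.
Proof. by have := coef_bound 'X^0 0; rewrite coefXn eqxx normr1 MX mulr1. Qed.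

Variables (m : nat -> nat) (E : nat -> (nat -> R) -> R).
Hypothesis minc : forall i, (m i < m i.+1)%N.
Hypothesis xE : asym M (fun k => 'X^(m k)) E.

Lemma subseq_mono i j : (i < j)%N -> (m i < m j)%N.
Proof.
move=> /subnK <-; elim: (j - i.+1)%N => [|d IH]; first exact: minc.
by rewrite addSn; exact: ltn_trans IH (minc _).
Qed.

Lemma subseq_inj : injective m.
Proof.
move=> i j mij; case: (ltngtP i j) => // /subseq_mono; by rewrite mij ltnn.
Qed.

Lemma subseq_ge i : (i <= m i)%N.
Proof. by elim: i => // i IH; exact: leq_ltn_trans IH (minc i). Qed.

(** Shifted by [K >= n], the [n] positions and all their subsets belong to [S_1], so in the limit
    every coordinate projection is bounded by [C]. *)
Lemma suppression n (P : pred nat) a :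
  E n (fun i => if P i then a i else 0) <= C * E n a.
Proof.
have C0 : 0 <= C by exact: le_trans schreier_ge1.
apply: (asym_le (k := addn) (k' := addn) (K1 := n) xE xE) => // K nK.
rewrite addn0; split=> //; try exact: incr_on_shift.
pose F := [seq m (K + i)%N | i <- [seq i <- iota 0 n | P i]].
have sF : schreier1 F.
  split.
    rewrite map_inj_uniq ?filter_uniq ?iota_uniq // => i j /subseq_inj; lia.
  move=> _ /mapP[i _ ->]; rewrite size_map size_filter.
  apply: leq_trans (count_size _ _) _; rewrite size_iota.
  by have := subseq_ge (K + i); lia.
apply: le_trans (SU _ sF); rewrite restr_sum le_eqVlt; apply/orP; left; apply/eqP.
congr M; apply: eq_bigr => i _; rewrite restrZ restrX.
have -> : (m (K + i)%N \in F) = P i.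
  rewrite (mem_map (f := fun i => m (K + i)%N)) ?mem_filter ?mem_iota ?ltn_ord ?andbT //.
  by move=> i' j' /subseq_inj; lia.
by case: ifP => _; rewrite ?scaler0 ?scale0r.
Qed.

Lemma asym_lattice n (a b : nat -> R) : (forall i, (i < n)%N -> `|a i| <= `|b i|) ->
  E n a <= 2 * C * E n b.
Proof.
apply: lattice_le.
- by move=> ? ? ? ?; exact: (asym_ext xE).
- by move=> ? ? ?; exact: (asymD sM xE).
- by move=> ? ? ?; exact: (asymZ sM xE).
- by move=> ? ? ?; exact: suppression.
Qed.

Lemma coef_comb n (a : nat -> R) k j : incr_on n k -> (j < n)%N ->
  `|a j| <= C * M (\sum_(i < n) a i *: 'X^(m (k i))).
Proof.
move=> kinc jn.
have kmono i i' : (i < i')%N -> (i' < n)%N -> (k i < k i')%N.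
  elim: i' => // i' IH; rewrite ltnS leq_eqVlt => /orP[/eqP<- jr|ij jr].
    exact: kinc.
  by apply: ltn_trans (IH ij (ltnW jr)) _; exact: kinc.
apply: le_trans (coef_bound _ (m (k j))).
rewrite coef_sum (bigD1 (Ordinal jn)) //= coefZ coefXn eqxx mulr1 big1 ?addr0 // => i ij.
rewrite coefZ coefXn; case: eqP => [/subseq_inj kk|_]; last by rewrite mulr0.
case/negP: ij; apply/eqP/val_inj => /=; case: (ltngtP i j) => // h.
  by have := kmono _ _ h jn; rewrite kk ltnn.
by have := kmono _ _ h (ltn_ord i); rewrite kk ltnn.
Qed.

Lemma asym_coef n (a : nat -> R) j : (j < n)%N -> `|a j| <= C * E n a.
Proof.
move=> jn; have C0 : 0 < C by exact: lt_le_trans schreier_ge1.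
rewrite -ler_pdivrMl //; apply: (asym_ge (K1 := 0%N) xE) => k kinc _.
by rewrite ler_pdivrMl // coef_comb.
Qed.

Lemma asym_single : E 1 (fun=> 1) = 1.
Proof.
apply/eqP; rewrite eq_sym -subr_eq0 -normr_le0; apply/ler_addgt0Pl => e e0.
have [K0 H] := asym_eps 1 (fun=> 1) xE e0; rewrite addr0.
have := H (addn K0) (@incr_on_shift _ _); rewrite addn0 => /(_ (leqnn _)).
by rewrite big_ord1 scale1r MX.
Qed.

Lemma asym_basis_generates : exists (W : normedModType R) (xt : nat -> W),
  (forall n a, comb_norm xt n a = E n a) /\
  generates_spreading_model M (fun k => 'X^(m k)) xt.
Proof.
have C0 : 0 < C by exact: lt_le_trans schreier_ge1.
apply: (@asym_generates _ _ _ _ _ C^-1 sM xE); first by rewrite invr_gt0.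
by move=> n a k j kinc jn; rewrite ler_pdivrMl // coef_comb.
Qed.

Definition unique_spreading_model : Prop :=
  forall (x1 : nat -> {poly R}) (W1 : normedModType R) (xt1 : nat -> W1)
         (x2 : nat -> {poly R}) (W2 : normedModType R) (xt2 : nat -> W2),
    vanishing x1 -> (forall k, M (x1 k) = 1) -> generates_spreading_model M x1 xt1 ->
    vanishing x2 -> (forall k, M (x2 k) = 1) -> generates_spreading_model M x2 xt2 ->
    equiv_seq (comb_norm xt1) (comb_norm xt2).

(** * Gluing blocks into one vanishing sequence *)

Section gliding.
Variables (ll : nat -> nat) (bb : nat -> nat -> R).
Hypothesis bb1 : forall j, E (ll j) (bb j) = 1.

Definition offset j := (\sum_(i < j) ll i)%N.
(** [glide k] occupies the [offset k.+1] positions from [start k] on. Adding [offset k'.+2] does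
    more than prevent overlaps: it forces [offset k.+1 <= start k], so that each block starts beyond
    its own length and [asym] applies to it. *)
Fixpoint start k := if k is k'.+1 then (start k' + offset k'.+2).+1 else offset 1.
Definition block j k : {poly R} :=
  \sum_(r < ll j) bb j r *: 'X^(m (start k + offset j + r)).
Definition glide k : {poly R} := \sum_(j < k.+1) (2 ^+ j)^-1 *: block j k.

Lemma offsetS j : offset j.+1 = (offset j + ll j)%N.
Proof. by rewrite /offset big_ord_recr. Qed.

Lemma offset_mono i j : (i <= j)%N -> (offset i <= offset j)%N.
Proof.
move=> /subnK <-; elim: (j - i)%N => // d IH; rewrite addSn offsetS; lia.
Qed.

Lemma offset_start k : (offset k.+1 <= start k)%N.
Proof. by case: k => // k /=; rewrite leqW // leq_addl. Qed.

Lemma start_mono i j : (i < j)%N -> (start i + offset i.+1 < start j)%N.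
Proof.
move=> /subnK <-; elim: (j - i.+1)%N => [|d IH].
  rewrite add0n /=; have := @offset_mono i.+1 i.+2; lia.
rewrite addSn /= ; lia.
Qed.

Lemma start_ge k : (k <= start k)%N.
Proof. by elim: k => //= k IH; lia. Qed.

Lemma ll_start j k : (j <= k)%N -> (ll j <= start k)%N.
Proof.
move=> jk; have := offset_start k; have := @offset_mono j.+1 k.+1 jk.
by rewrite offsetS; lia.
Qed.

Lemma glide_index j k r j' k' r' : (j <= k)%N -> (r < ll j)%N -> (j' <= k')%N ->
  (r' < ll j')%N -> (start k + offset j + r = start k' + offset j' + r')%N ->
  [/\ k = k', j = j' & r = r'].
Proof.
move=> jk rl jk' rl' eq.
have u1 := @offset_mono j.+1 k.+1 jk; have u2 := @offset_mono j'.+1 k'.+1 jk'.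
rewrite offsetS in u1; rewrite offsetS in u2.
have kk : k = k'.
  case: (ltngtP k k') => // /start_mono; lia.
rewrite -kk in eq *.
have jj : j = j'.
  case: (ltngtP j j') => // /offset_mono; rewrite offsetS; lia.
by rewrite -jj in eq *; split=> //; lia.
Qed.

Lemma ll_gt0 j : (0 < ll j)%N.
Proof.
rewrite lt0n; apply/eqP => h; have := bb1 j.
rewrite (asym0 sM xE) => [/esym/eqP|i]; rewrite ?oner_eq0 //.
by rewrite h.
Qed.

Lemma block_norm j k : (j <= k)%N -> M (block j k) <= 1 + C.
Proof.
move=> jk; have C0 : 0 <= C by exact: le_trans schreier_ge1.
have := xE (n := ll j) (a := bb j) (k := addn (start k + offset j)) C0 _ _ _.
rewrite addn0 bb1 -/(block j k).
have h1 : forall i, (i < ll j)%N -> `|bb j i| <= C.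
  by move=> i il; apply: le_trans (asym_coef _ il) _; rewrite bb1 mulr1.
move=> /(_ h1 (@incr_on_shift _ _)) h; have {h} : `|M (block j k) - 1| <= C.
  apply: le_trans (h _) _; first by have := ll_start jk; lia.
  by rewrite ler_pdivrMr ?ltr0n // ler_peMr // ler1n.
by rewrite ler_distl => /andP[_].
Qed.

Lemma glide_norm k : M (glide k) <= 2 * (1 + C).
Proof.
have C0 : 0 <= 1 + C by rewrite addr_ge0 //; exact: le_trans schreier_ge1.
apply: le_trans (seminorm_sum sM _ _ _) _.
apply: (@le_trans _ _ (\sum_(j < k.+1) (2 ^+ j)^-1 * (1 + C))).
  apply: ler_sum => j _; rewrite seminormZ // ger0_norm ?invr_ge0 ?exprn_ge0 //.
  by rewrite ler_wpM2l ?invr_ge0 ?exprn_ge0 // block_norm // -ltnS.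
rewrite -mulr_suml ler_wpM2r //.
have -> : \sum_(j < k.+1) (2 ^+ j)^-1 = 2 - (2 ^+ k)^-1 :> R.
  elim: k => [|k IH]; first by rewrite big_ord1 expr0 invr1; ring.
  rewrite big_ord_recr /= IH exprS; field.
  by rewrite expf_neq0.
by rewrite gerBl invr_ge0 exprn_ge0.
Qed.

Lemma coef_glide j k r k' : (j <= k)%N -> (r < ll j)%N ->
  (glide k')`_(m (start k + offset j + r)) =
  if k == k' then (2 ^+ j)^-1 * bb j r else 0.
Proof.
move=> jk rl; rewrite /glide coef_sum.
have C1 (j' : 'I_k'.+1) (r' : 'I_(ll j')) :
    (start k + offset j + r = start k' + offset j' + r')%N -> [/\ k = k', j = j' & r = r' :> nat].
  by apply: glide_index => //; rewrite -ltnS.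
case: eqP => [kk|kk]; last first.
  rewrite big1 // => j' _; rewrite coefZ /block coef_sum big1 ?mulr0 // => r' _.
  rewrite coefZ coefXn; case: eqP => [/subseq_inj/C1[]//|_]; by rewrite mulr0.
rewrite -kk in C1 *; have jk' : (j < k.+1)%N by [].
rewrite (bigD1 (Ordinal jk')) //= big1 ?addr0 => [|j' jj'].
  rewrite coefZ /block coef_sum (bigD1 (Ordinal rl)) //= big1 ?addr0 => [|r' rr'].
    by rewrite coefZ coefXn eqxx mulr1.
  rewrite coefZ coefXn; case: eqP => [/subseq_inj eq|_]; last by rewrite mulr0.
  by case/negP: rr'; apply/eqP/val_inj => /=; lia.
rewrite coefZ /block coef_sum big1 ?mulr0 // => r' _.
rewrite coefZ coefXn; case: eqP => [/subseq_inj/C1[_ h _]|_]; last by rewrite mulr0.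
by case/negP: jj'; apply/eqP/val_inj.
Qed.

(** By [glide_index] the positions of distinct blocks are disjoint, so the set of positions of all
    [j]-th blocks cuts each glued vector down to its [j]-th summand. *)
Lemma restr_glide n j (k : nat -> nat) i : (i < n)%N -> (j <= k i)%N ->
  (forall i, (i < n)%N -> (j <= k i)%N) ->
  restr [seq m (start (k q.1) + offset j + q.2) |
           q <- [seq (i, r) | i <- iota 0 n, r <- iota 0 (ll j)]] (glide (k i)) =
  (2 ^+ j)^-1 *: block j (k i).
Proof.
set F := [seq _ | _ <- _] => ilt jk jks.
have C1 j' r' : (j' <= k i)%N -> (r' < ll j')%N ->
    (m (start (k i) + offset j' + r') \in F) = (j' == j :> nat).
  move=> jk' rl'.
  apply/mapP/eqP => [[[i1 r1] /allpairsP[[i2 r2] /= [+ + [-> ->]]] /subseq_inj]|jj].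
    rewrite !mem_iota /= !add0n => h1 h2 /glide_index; case=> //.
    exact: jks.
  exists (i, r') => /=; last by rewrite jj.
  apply/allpairsP; exists (i, r'); rewrite !mem_iota /= !add0n ilt.
  by rewrite -jj rl'.
have jk' : (j < (k i).+1)%N by [].
rewrite /glide restr_sum (bigD1 (Ordinal jk')) //= big1 ?addr0 => [|j' jj'].
  rewrite restrZ /block restr_sum; congr (_ *: _); apply: eq_bigr => r _.
  by rewrite restrZ restrX C1 ?eqxx.
rewrite restrZ /block restr_sum big1 ?scaler0 // => r _.
rewrite restrZ restrX C1 //; last by rewrite -ltnS.
case: eqP => [h|_]; last by rewrite scaler0.
by case/negP: jj'; apply/eqP/val_inj.
Qed.

Lemma vanishing_basis : vanishing (fun k => 'X^(m k) : {poly R}).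
Proof.
move=> i; exists i.+1 => k ik; rewrite coefXn; case: eqP => // h.
by have := subseq_ge k; lia.
Qed.

(** Let [L'] be the limit norm of the normalized glued vectors. A Schreier projection onto the
    [j]-th blocks of [n] of them bounds the copies of [bb j] by a multiple of [2 ^+ j * L' n a], and
    uniqueness bounds [L'] by [E]. The point is that [D] does not depend on [j]. *)
Lemma glide_dominates : unique_spreading_model ->
  exists D, forall j n a, E (n * ll j) (tens (ll j) a (bb j)) <= 2 ^+ j * D * E n a.
Proof.
move=> uniq_sm; have C1 := schreier_ge1; have C0 : 0 < C by exact: lt_le_trans C1.
(* A nonzero coefficient of block 0, whose weight is 1, keeps the norms of all glued vectors away
   from 0; it also provides the lower estimate that [asym_generates] requires. *)
have [r0 r0l br0] : exists2 r, (r < ll 0)%N & bb 0 r != 0.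
  apply: contrapT => h; have := bb1 0; rewrite (asym0 sM xE) => [/esym/eqP|r rl].
    by rewrite oner_eq0.
  by apply: contrapT => /eqP b0; apply: h; exists r.
set bt := `|bb 0 r0|; have bt0 : 0 < bt by rewrite normr_gt0.
have glow k : bt / C <= M (glide k).
  rewrite ler_pdivrMr // mulrC.
  have := coef_bound (glide k) (m (start k + offset 0 + r0)).
  by rewrite coef_glide // eqxx expr0 invr1 mul1r.
have gpos k : 0 < M (glide k) by apply: lt_le_trans (glow k); rewrite divr_gt0.
have [Bd Bd0 glide_norm] : exists2 Bd, 0 < Bd & forall k, M (glide k) <= Bd.
  by exists (2 * (1 + C)); [lra|exact: glide_norm].
have C0' := ltW C0; have Bd0' := ltW Bd0; have bt0' := ltW bt0.
pose z k := (M (glide k))^-1 *: glide k.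
have z1 k : M (z k) = 1.
  by rewrite /z seminormZ // gtr0_norm ?invr_gt0 // mulVf // gt_eqF.
have zv : vanishing z.
  move=> i; exists i.+1 => k ik; rewrite coefZ; suff -> : (glide k)`_i = 0 by rewrite mulr0.
  rewrite coef_sum big1 // => j _.
  rewrite coefZ /block coef_sum big1 ?mulr0 // => r _; rewrite coefZ coefXn.
  case: eqP => [h|_]; last by rewrite mulr0.
  by have := subseq_ge (start k + offset j + r); have := start_ge k; lia.
have [m' [L' [m'inc zL']]] : exists m' L', (forall i, (m' i < m' i.+1)%N) /\ asym M (z \o m') L'.
  by apply: (brunel_sucheston sM (B := 1)) => k; rewrite z1.
have m'ge i : (i <= m' i)%N.
  by elim: i => // i IH; exact: leq_ltn_trans IH (m'inc i).
have m'mono i j : (i < j)%N -> (m' i < m' j)%N.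
  move=> /subnK <-; elim: (j - i.+1)%N => [|d IH]; first exact: m'inc.
  by rewrite addSn; exact: ltn_trans IH (m'inc _).
have bC0 : 0 < bt / (C * Bd) by rewrite divr_gt0 // mulr_gt0.
have [W' [xt' [xtE' gen']]] : exists (W : normedModType R) (xt : nat -> W),
    (forall n a, comb_norm xt n a = L' n a) /\ generates_spreading_model M (z \o m') xt.
  apply: (asym_generates sM zL' bC0) => n a k j kinc jn.
  have kmono i i' : (i < i')%N -> (i' < n)%N -> (k i < k i')%N.
    elim: i' => // i' IH; rewrite ltnS leq_eqVlt => /orP[/eqP<- jr|ij jr].
      exact: kinc.
    by apply: ltn_trans (IH ij (ltnW jr)) _; exact: kinc.
  set p := \sum_(i < n) _.
  have := coef_bound p (m (start (m' (k j)) + offset 0 + r0)).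
  have -> : p`_(m (start (m' (k j)) + offset 0 + r0)) =
            a j * ((M (glide (m' (k j))))^-1 * bb 0 r0).
    rewrite coef_sum (bigD1 (Ordinal jn)) //= big1 ?addr0 => [|i ij].
      by rewrite coefZ coefZ coef_glide // eqxx expr0 invr1 mul1r.
    rewrite coefZ coefZ coef_glide //; case: eqP => [h|_]; last by rewrite !mulr0.
    case/negP: ij; apply/eqP/val_inj => /=; case: (ltngtP i j) => // ij.
      by have := m'mono _ _ (kmono _ _ ij jn); rewrite h ltnn.
    by have := m'mono _ _ (kmono _ _ ij (ltn_ord i)); rewrite h ltnn.
  rewrite !normrM normfV (gtr0_norm (gpos _)) -/bt => h.
  rewrite -(ler_pM2l C0); apply: le_trans h.
  have -> : C * (bt / (C * Bd) * `|a j|) = `|a j| * (Bd^-1 * bt).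
    by field; rewrite !gt_eqF.
  rewrite ler_wpM2l // ler_wpM2r ?(ltW bt0) // lef_pV2 ?posrE //.
have [W1 [xt1 [xtE1 gen1]]] := asym_basis_generates.
have zv' : vanishing (z \o m').
  move=> i; have [K0 hK] := zv i; exists K0 => k Kk; apply: hK.
  exact: leq_trans Kk (m'ge k).
have [K1 [K10 HK1]] := uniq_sm _ _ _ _ _ _ zv' (fun k => z1 (m' k)) gen'
  vanishing_basis (fun k => MX (m k)) gen1.
(* [2 * C] and [Bd] come from undoing the normalization of the glued vectors, the other [C] from the
   Schreier projection, and [K1] from uniqueness. *)
exists (2 * C * Bd * C * K1) => j n a.
suff H : E (n * ll j) (tens (ll j) a (bb j)) <= 2 ^+ j * (2 * C * Bd * C) * L' n a.
  apply: le_trans H _; have /andP[_] := HK1 n a; rewrite xtE' xtE1 => h.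
  have -> : 2 ^+ j * (2 * C * Bd * C * K1) * E n a = 2 ^+ j * (2 * C * Bd * C) * (K1 * E n a) by ring.
  by apply: ler_wpM2l h; rewrite !mulr_ge0 ?exprn_ge0.
set A := \sum_(i < n) `|a i|.
have A0 : 0 <= A by exact: sumr_ge0.
have aA i : (i < n)%N -> `|a i| <= A.
  by move=> ilt; rewrite /A (bigD1 (Ordinal ilt)) //= lerDl sumr_ge0.
set l := ll j; have l0 : (0 < l)%N by exact: ll_gt0.
have bC r : (r < l)%N -> `|bb j r| <= C.
  by move=> rl; apply: le_trans (asym_coef _ rl) _; rewrite bb1 mulr1.
have Mx0 : 0 <= A / (bt / C) * C by rewrite mulr_ge0 ?divr_ge0.
apply/ler_addgt0Pr => e e0.
set d := e / (2 * C * Bd * (2 ^+ j * C + 1)).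
have j2 : 0 < 2 ^+ j :> R by rewrite exprn_gt0.
have q0 : 0 < 2 ^+ j * C + 1 by rewrite ltr_wpDl // mulr_ge0 // exprn_ge0.
have d0 : 0 < d by rewrite divr_gt0 // !mulr_gt0.
(* The coefficients [c] introduced below depend on the positions, hence on [K], so the convergence
   has to be uniform over all vectors with this bound. *)
have [Ka HKa] := asym_eps_unif (n * l) xE Mx0 d0.
have [Kb HKb] := asym_eps n a zL' d0.
have [K [KKa KKb Kj Knl]] : exists K, [/\ (Ka <= K)%N, (Kb <= K)%N, (j <= K)%N & (n * l <= K)%N].
  exists (maxn (maxn Ka Kb) (maxn j (n * l))).
  by rewrite !leq_max !leqnn !orbT.
pose kk i := m' (K + i)%N.
have kkge i : (K <= kk i)%N by apply: leq_trans (m'ge _); rewrite leq_addr.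
have kkmono i i' : (i < i')%N -> (kk i < kk i')%N by move=> h; apply: m'mono; rewrite ltn_add2l.
have kkj i : (j <= kk i)%N by exact: leq_trans Kj (kkge i).
pose c i := a i / M (glide (kk i)).
pose idx I := (start (kk (I %/ l)) + offset j + I %% l)%N.
pose F := [seq m (start (kk q.1) + offset j + q.2) |
           q <- [seq (i, r) | i <- iota 0 n, r <- iota 0 (ll j)]].
(* [F] has [n * l] elements, all of them at least [K >= n * l]. *)
have sF : schreier1 F.
  split.
    rewrite map_inj_in_uniq.
      by rewrite allpairs_uniq ?iota_uniq // => -[? ?] [? ?].
    move=> [i1 r1] [i2 r2] /allpairsP[[i3 r3] /= [_ + [-> ->]]].
    move=> + /allpairsP[[i4 r4] /= [_ + [-> ->]]]; rewrite !mem_iota /= !add0n.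
    move=> h3 h4 /subseq_inj /glide_index[//|//|//|//|h5 _ h6].
    rewrite h6; congr (_, _); case: (ltngtP i3 i4) => // /kkmono; by rewrite h5 ltnn.
  move=> _ /mapP[[i r] _ ->]; rewrite size_map size_allpairs !size_iota /=.
  apply: leq_trans Knl _; apply: leq_trans (kkge i) _; apply: leqW.
  apply: leq_trans (start_ge _) _; apply: leq_trans (subseq_ge _).
  by rewrite -addnA leq_addr.
have E1 : restr F (\sum_(i < n) a i *: z (kk i)) =
   (2 ^+ j)^-1 *: \sum_(I < n * l) tens l c (bb j) I *: 'X^(m (idx I)).
  rewrite restr_sum /tens /idx.
  rewrite (@sum_divmod _ n l (fun i r => (c i * bb j r) *: 'X^(m (start (kk i) + offset j + r)))) //.
  rewrite scaler_sumr; apply: eq_bigr => i _.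
  rewrite restrZ /z restrZ restr_glide //.
  rewrite /block !scalerA !scaler_sumr; apply: eq_bigr => r _.
  by rewrite !scalerA /c; congr (_ *: _); ring.
have inc_idx : incr_on (n * l) idx.
  move=> I _; rewrite /idx.
  have [h|h] := ltnP (I %% l).+1 l.
    have dE : (I.+1 = (I %/ l) * l + (I %% l).+1)%N by rewrite addnS -divn_eq.
    by rewrite dE divnMDl // modnMDl (divn_small h) (modn_small h) addn0 addnS.
  have dE : (I.+1 = ((I %/ l).+1) * l + 0)%N.
    have hl : l = (I %% l).+1 by apply/eqP; rewrite eqn_leq h ltn_pmod.
    by rewrite addn0 mulSn [X in (X + _)%N]hl addSn addnC -divn_eq.
  rewrite dE divnMDl // modnMDl mod0n div0n addn0.
  apply: (@leq_trans (start (kk (I %/ l).+1))); last by rewrite ?addn0 leq_addr.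
  apply: leq_trans (start_mono (kkmono _ _ (ltnSn (I %/ l)))).
  rewrite ltnS -addnA leq_add2l.
  have /offset_mono h1 : (j.+1 <= (kk (I %/ l)).+1)%N by rewrite ltnS.
  by apply: leq_trans h1; rewrite offsetS leq_add2l ltnW // ltn_pmod.
have b1 I : (I < n * l)%N -> `|tens l c (bb j) I| <= A / (bt / C) * C.
  move=> /divmod_lt[i1 r1]; rewrite /tens normrM ler_pM ?normr_ge0 ?bC //.
  rewrite /c normrM normfV (gtr0_norm (gpos _)) ler_pM ?invr_ge0 ?aA //; first exact: ltW.
  by rewrite lef_pV2 ?posrE // divr_gt0.
have b2 : (Ka <= idx 0%N)%N.
  rewrite /idx -addnA; apply: leq_trans (leq_addr _ _); apply: leq_trans (start_ge _).
  exact: leq_trans (kkge _).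
have := HKa _ idx b1 inc_idx b2; rewrite ler_distl => /andP[h1 _].
have b3 : (Kb <= K + 0)%N by rewrite addn0.
have := HKb (addn K) (@incr_on_shift _ _) b3; rewrite ler_distl => /andP[_ h2].
have h3 := SU (\sum_(i < n) a i *: z (kk i)) sF.
rewrite E1 seminormZ // gtr0_norm ?invr_gt0 // ler_pdivrMl // in h3.
have h4 : E (n * l) (tens l a (bb j)) <= 2 * C * (Bd * E (n * l) (tens l c (bb j))).
  have <- : E (n * l) (fun i => Bd * tens l c (bb j) i) = Bd * E (n * l) (tens l c (bb j)).
    by rewrite (asymZ sM xE) gtr0_norm.
  apply: asym_lattice => I _; rewrite /tens /c mulrA !normrM ler_wpM2r //.
  rewrite (gtr0_norm Bd0) normfV (gtr0_norm (gpos _)) mulrA ler_pdivlMr //.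
  by rewrite mulrC ler_wpM2r // glide_norm.
apply: le_trans h4 _.
have -> : e = 2 * C * Bd * (2 ^+ j * C * d + d).
  by rewrite /d; field; rewrite !gt_eqF.
have -> : 2 ^+ j * (2 * C * Bd * C) * L' n a + 2 * C * Bd * (2 ^+ j * C * d + d) =
   2 * C * Bd * (2 ^+ j * C * (L' n a + d) + d) by ring.
rewrite mulrA; apply: ler_wpM2l; first by rewrite !mulr_ge0.
set Y := M (\sum_(I < n * l) _) in h1 h3.
set Z := M (\sum_(i < n) a i *: z (kk i)) in h3.
have h5 : Z <= L' n a + d by exact: h2.
have h6 : 2 ^+ j * (C * Z) <= 2 ^+ j * C * (L' n a + d).
  by rewrite mulrA; apply: ler_wpM2l => //; rewrite mulr_ge0 // exprn_ge0.
lra.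
Qed.

End gliding.

Theorem tens_upper : unique_spreading_model ->
  exists K, 0 < K /\ forall n a l b, E (n * l) (tens l a b) <= K * E n a * E l b.
Proof.
move=> uniq_sm; apply: contrapT => noK.
have C0 : 0 < C by exact: lt_le_trans schreier_ge1.
have bad j : exists w : nat * (nat -> R) * nat * (nat -> R),
    E w.1.2 w.2 = 1 /\
    4 ^+ j * E w.1.1.1 w.1.1.2 < E (w.1.1.1 * w.1.2) (tens w.1.2 w.1.1.2 w.2).
  apply: contrapT => nw; apply: noK; exists (4 ^+ j); split; first by rewrite exprn_gt0.
  move=> n a l b; rewrite leNgt; apply/negP => lt.
  (* If [E l b] vanishes then so does [b], and there is no violation; otherwise [b] can be
     normalized, as gluing requires. *)
  have [b0|b0] := ltP 0 (E l b); last first.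
    have bz i : (i < l)%N -> b i = 0.
      move=> il; apply/eqP; rewrite -normr_le0; apply: le_trans (asym_coef _ il) _.
      by rewrite pmulr_rle0.
    move: lt; rewrite (asym0 sM xE (a := tens l a b)) => [|I /divmod_lt[_ h]].
      rewrite ltNge mulr_ge0 ?(asym_ge0 sM xE) // mulr_ge0 ?exprn_ge0 //.
      exact: (asym_ge0 sM xE).
    by rewrite /tens bz // mulr0.
  apply: nw; exists (n, a, l, fun i => (E l b)^-1 * b i) => /=.
  rewrite (asymZ sM xE) gtr0_norm ?invr_gt0 // mulVf ?gt_eqF //; split=> //.
  rewrite (asym_ext xE (a := tens l a _) (b := fun i => (E l b)^-1 * tens l a b i)); last first.
    by move=> i _; rewrite /tens; ring.
  by rewrite (asymZ sM xE) gtr0_norm ?invr_gt0 // [X in _ < X]mulrC ltr_pdivlMr.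
have [w wP] := choice bad.
have bb1 j : E (w j).1.2 (w j).2 = 1 by have [] := wP j.
have [D HD] := glide_dominates bb1 uniq_sm.
have lt2 j : 2 ^+ j < D.
  have [_ h] := wP j; have h2 := HD j (w j).1.1.1 (w j).1.1.2.
  have {h h2} := lt_le_trans h h2.
  set y := E _ _; have : 0 <= y by exact: (asym_ge0 sM xE).
  rewrite le_eqVlt => /orP[/eqP<-|y0]; first by rewrite !mulr0 ltxx.
  rewrite ltr_pM2r // (_ : 4 = 2 * 2) ?exprMn ?ltr_pM2l ?exprn_gt0 //.
  by rewrite -natrM.
have := lt2 (Num.truncn D).+1; apply/negP; rewrite -leNgt.
apply: le_trans (ltW (truncnS_gt D)) _.
by rewrite -natrX ler_nat ltnW // ltn_expl.
Qed.

End schreier.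

(** * Multiplicative norms are c_0 or l_p *)

Section real_lemmas.
Variable R : realType.

(** A ratio in [(0, 1]] does not decrease under a power [al <= 1]; apply this to [x / (x + y)] and
    [y / (x + y)] and add. *)
Lemma powR_subadd (x y al : R) : 0 <= x -> 0 <= y -> 0 <= al <= 1 ->
  (x + y) `^ al <= x `^ al + y `^ al.
Proof.
move=> x0 y0 /andP[al0 al1].
have := x0; rewrite le_eqVlt => /orP[/eqP<-|xp].
  by rewrite add0r lerDr powR_ge0.
have := y0; rewrite le_eqVlt => /orP[/eqP<-|yp].
  by rewrite addr0 lerDl powR_ge0.
have s0 : 0 < x + y by rewrite addr_gt0.
have part z : 0 < z -> z <= x + y -> z / (x + y) * (x + y) `^ al <= z `^ al.
  move=> z0 zs; have -> : z `^ al = (z / (x + y)) `^ al * (x + y) `^ al.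
    by rewrite -powRM ?divr_ge0 ?divfK ?gt_eqF // ltW.
  rewrite ler_wpM2r ?powR_ge0 //; apply: ger1_powR => //.
  by rewrite divr_gt0 //= ler_pdivrMr // mul1r.
have h1 := part x xp (ltac:(lra)); have h2 := part y yp (ltac:(lra)).
apply: le_trans (lerD h1 h2); rewrite -mulrDl -mulrDl divff ?gt_eqF //.
by rewrite mul1r.
Qed.

(** Estimating [psi] at the product of [i] and [j] in two ways gives
    [(psi j - k) / j <= (psi i + k) / i] for all positive [i] and [j]; a number separating the two
    families is the slope. *)
Lemma quasi_additive (psi : nat -> R) (k : R) :
  (forall i j, `|psi (i + j)%N - psi i - psi j| <= k) ->
  exists al, forall j, `|psi j - j%:R * al| <= k.
Proof.
move=> qa; have k0 : 0 <= k by exact: le_trans (normr_ge0 _) (qa 0%N 0%N).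
have mul i j : `|psi (i.+1 * j)%N - i.+1%:R * psi j| <= i.+1%:R * k.
  elim: i => [|i IH]; first by rewrite !mul1r mul1n subrr normr0.
  have -> : psi (i.+2 * j)%N - i.+2%:R * psi j =
    (psi (j + i.+1 * j)%N - psi j - psi (i.+1 * j)%N) + (psi (i.+1 * j)%N - i.+1%:R * psi j).
    by rewrite mulSn -[in LHS](natr1 i.+1); ring.
  apply: le_trans (ler_normD _ _) _; rewrite -[in leRHS](natr1 i.+1) mulrDl mul1r addrC.
  by rewrite lerD.
have fek i j : (psi j.+1 - k) / j.+1%:R <= (psi i.+1 + k) / i.+1%:R.
  rewrite ler_pdivrMr ?ltr0n // mulrAC ler_pdivlMr ?ltr0n //.
  have := mul i j.+1; have := mul j i.+1; rewrite [(j.+1 * _)%N]mulnC.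
  rewrite !ler_distl => /andP[h1 h2] /andP[h3 h4]; lra.
pose A := [set (psi j.+1 - k) / j.+1%:R | j in [set: nat]].
have hsA : has_sup A.
  split; first by exists ((psi 1%N - k) / 1%:R); exists 0%N.
  by exists ((psi 1%N + k) / 1%:R) => _ [j _ <-]; exact: fek.
exists (sup A) => -[|j].
  rewrite mul0r subr0; have := qa 0%N 0%N; rewrite addn0.
  by rewrite subrr sub0r normrN.
rewrite ler_distl; apply/andP; split.
  have h : sup A <= (psi j.+1 + k) / j.+1%:R.
    by apply: ge_sup; [case: hsA|move=> _ [i _ <-]; exact: fek].
  move: h; rewrite ler_pdivlMr ?ltr0n //; lra.
have h : (psi j.+1 - k) / j.+1%:R <= sup A.
  by apply: ub_le_sup; [case: hsA|exists j].
move: h; rewrite ler_pdivrMr ?ltr0n //; lra.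
Qed.

Lemma bernoulli (h : R) r : 0 <= h -> 1 + r%:R * h <= (1 + h) ^+ r.
Proof.
move=> h0; elim: r => [|r IH]; first by rewrite mul0r addr0 expr0.
rewrite exprS; apply: (@le_trans _ _ ((1 + h) * (1 + r%:R * h))); last first.
  by rewrite ler_wpM2l // addr_ge0.
rewrite -natr1; have : 0 <= r%:R * h * h by rewrite !mulr_ge0.
lra.
Qed.

(** If [x = 1 + h] with [h > 0], Bernoulli gives [x ^+ r >= r h]; squaring makes [x ^+ (r + r)] at
    least quadratic in [r], beyond any linear bound. *)
Lemma exp_le_linear (x a b : R) : 0 <= x -> 0 <= a -> 0 <= b ->
  (forall r, x ^+ r <= a + b * r%:R) -> x <= 1.
Proof.
move=> x0 a0 b0 H; rewrite leNgt; apply/negP => x1.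
pose h := x - 1; have h0 : 0 < h by rewrite subr_gt0.
pose r := (Num.truncn ((a + 2 * b) / h ^+ 2)).+1.
have hr : a + 2 * b < r%:R * h ^+ 2.
  by rewrite -ltr_pdivrMr ?exprn_gt0 //; exact: truncnS_gt.
have r1 : 1 <= r%:R :> R by rewrite ler1n.
have := H (r + r)%N; rewrite exprD natrD leNgt => /negP; apply.
have hb : r%:R * h <= x ^+ r.
  have xE : 1 + h = x by rewrite /h; ring.
  have := bernoulli r (ltW h0); rewrite xE; lra.
have rh0 : 0 <= r%:R * h by rewrite mulr_ge0 // ltW.
have hb2 := ler_pM rh0 rh0 hb hb; apply: lt_le_trans hb2.
have -> : r%:R * h * (r%:R * h) = r%:R * (r%:R * h ^+ 2) by ring.
apply: (@le_lt_trans _ _ (r%:R * (a + 2 * b))).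
  have : 0 <= a * (r%:R - 1) by rewrite mulr_ge0 // subr_ge0.
  lra.
by rewrite ltr_pM2l // (lt_le_trans _ r1).
Qed.

End real_lemmas.

(** * Comparing two norms level by level *)

Section levels.
Variables (R : realType) (M1 M2 : nat -> (nat -> R) -> R) (A D : R).
Hypothesis M1ext : forall n a b, (forall i, (i < n)%N -> a i = b i) -> M1 n a = M1 n b.
Hypothesis M1split : forall n (P : pred nat) a,
  M1 n a <= M1 n (fun i => if P i then a i else 0) + M1 n (fun i => if P i then 0 else a i).
Hypothesis M2sup : forall n (P : pred nat) a,
  M2 n (fun i => if P i then a i else 0) <= D * M2 n a.
Hypothesis A0 : 0 <= A.
Hypothesis flat : forall n a (t : R), 0 < t ->
  (forall i, (i < n)%N -> a i = 0 \/ t <= `|a i| <= 2 * t) -> M1 n a <= A * M2 n a.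

(** The entries above half of the maximal range form one flat level, and the rest has one level
    fewer. [M1] and [M2] are arbitrary because the comparison of [E] with the l_p norm is used in
    both directions. *)
Lemma levels n a (t : R) (J : nat) : 0 < t ->
  (forall i, (i < n)%N -> a i = 0 \/ t <= `|a i| <= 2 ^+ J * t) ->
  M1 n a <= J.+1%:R * (A * D * M2 n a).
Proof.
move=> t0.
have piece (Q : pred nat) (s : R) : 0 < s ->
    (forall i, (i < n)%N -> Q i -> a i = 0 \/ s <= `|a i| <= 2 * s) ->
    M1 n (fun i => if Q i then a i else 0) <= A * D * M2 n a.
  move=> s0 h; rewrite -mulrA; apply: le_trans (ler_wpM2l A0 (M2sup n Q a)).
  by apply: (flat s0) => i ilt; case: ifP => [/(h i ilt)//|_]; left.
(* Restricting to a predicate [Q] lets the induction on [J] continue on the lower levels of the same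
   vector. *)
suff H (Q : pred nat) : (forall i, (i < n)%N -> Q i -> a i = 0 \/ t <= `|a i| <= 2 ^+ J * t) ->
    M1 n (fun i => if Q i then a i else 0) <= J.+1%:R * (A * D * M2 n a).
  move=> h; have := H xpredT (fun i ilt _ => h i ilt).
  by rewrite (@M1ext n (fun i => if xpredT i then a i else 0) a).
elim: J Q => [|J IH] Q h.
  rewrite mul1r; apply: (piece _ t t0) => i ilt Qi.
  by have [->|/andP[h1 h2]] := h i ilt Qi; [left|right; rewrite h1 /=; lra].
pose P i := `|a i| <= 2 ^+ J * t.
apply: le_trans (M1split n P _) _.
rewrite -[J.+2%:R]natr1 mulrDl mul1r; apply: lerD.
  rewrite (@M1ext n _ (fun i => if P i && Q i then a i else 0)); last first.
    by move=> i _; case: (P i); case: (Q i).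
  apply: IH => i ilt /andP[Pi Qi]; have [->|/andP[h1 h2]] := h i ilt Qi; [by left|].
  by right; rewrite h1.
rewrite (@M1ext n _ (fun i => if ~~ P i && Q i then a i else 0)); last first.
  by move=> i _; case: (P i); case: (Q i).
have s0 : 0 < 2 ^+ J * t by rewrite mulr_gt0 // exprn_gt0.
apply: (piece _ _ s0) => i ilt /andP[]; rewrite -ltNge => /ltW h1 Qi.
have [->|/andP[_ h2]] := h i ilt Qi; [by left|right].
by rewrite h1 /= mulrA -exprS.
Qed.

End levels.

Lemma count_sum (R : realType) n (P : pred nat) :
  (count P (iota 0 n))%:R = \sum_(i < n) (P i)%:R :> R.
Proof.
elim: n => [|n IH]; first by rewrite big_ord0.
by rewrite -addn1 iotaD count_cat natrD IH addn1 big_ord_recr /= add0n addn0.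
Qed.

Lemma arch_le0 (R : realType) (x c : R) : (forall j : nat, j%:R * x <= c) -> x <= 0.
Proof.
move=> H; rewrite leNgt; apply/negP => x0.
have := H (Num.truncn (c / x)).+1; apply/negP; rewrite -ltNge.
by rewrite -ltr_pdivrMr // truncnS_gt.
Qed.

Fixpoint tpow (R : realType) n (a : nat -> R) r : nat -> R :=
  if r is r'.+1 then tens (n ^ r') a (tpow n a r') else fun=> 1.

(** * Norms that are multiplicative up to a constant *)

Section multiplicative.
Variables (R : realType) (E : nat -> (nat -> R) -> R) (C D K : R).
Hypothesis Eext : forall n a b, (forall i, (i < n)%N -> a i = b i) -> E n a = E n b.
Hypothesis ED : forall n a b, E n (fun i => a i + b i) <= E n a + E n b.
Hypothesis EZ : forall n t a, E n (fun i => t * a i) = `|t| * E n a.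
Hypothesis D0 : 0 < D.
Hypothesis Elat : forall n (a b : nat -> R),
  (forall i, (i < n)%N -> `|a i| <= `|b i|) -> E n a <= D * E n b.
Hypothesis C0 : 0 < C.
Hypothesis Ecoef : forall n (a : nat -> R) j, (j < n)%N -> `|a j| <= C * E n a.
Hypothesis Eind : forall n (P : pred nat),
  E n (fun i => (P i)%:R) = E (count P (iota 0 n)) (fun=> 1).
Hypothesis E1 : E 1 (fun=> 1) = 1.
Hypothesis K1 : 1 <= K.
Hypothesis Kup : forall n a l b, E (n * l) (tens l a b) <= K * E n a * E l b.
Hypothesis Klo : forall n a l b, E n a * E l b <= K * E (n * l) (tens l a b).

Let K0 : 0 < K. Proof. exact: lt_le_trans K1. Qed.

Lemma mult_zero n a : (forall i, (i < n)%N -> a i = 0) -> E n a = 0.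
Proof.
move=> a0; rewrite (@Eext n a (fun i => 0 * a i)) ?EZ ?normr0 ?mul0r //.
by move=> i /a0->; rewrite mulr0.
Qed.

Lemma mult_ge0 n a : 0 <= E n a.
Proof.
have := ED n a (fun i => -1 * a i); rewrite EZ normrN1 mul1r.
rewrite mult_zero; last by move=> i _; ring.
by rewrite -mulr2n pmulrn_lge0.
Qed.

Definition fundamental n := E n (fun=> 1).

Lemma fundamental_mono m n : (m <= n)%N -> fundamental m <= D * fundamental n.
Proof.
move=> mn; have -> : fundamental m = E n (fun i => (i < m)%N%:R).
  rewrite (Eind n (fun i => i < m)%N) /fundamental; congr (E _ _).
  rewrite -(subnKC mn) iotaD count_cat (@eq_in_count _ _ predT) => [|i].
    rewrite count_predT size_iota (@eq_in_count _ _ pred0) ?count_pred0 ?addn0 // => i.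
    by rewrite mem_iota add0n => /andP[h _]; rewrite ltnNge h.
  by rewrite mem_iota add0n.
apply: Elat => i _; rewrite normr1; case: (i < m)%N; by rewrite ?normr1 ?normr0.
Qed.

Lemma fundamental_le n : fundamental n <= n%:R.
Proof.
elim: n => [|n IH]; first by rewrite /fundamental mult_zero.
rewrite -natr1; apply: le_trans (lerD IH (lexx 1)).
have -> : fundamental n.+1 = E n.+1 (fun i => (i < n)%N%:R + (i == n)%:R).
  apply: Eext => i; rewrite ltnS leq_eqVlt => /orP[/eqP->|h].
    by rewrite ltnn eqxx add0r.
  by rewrite h (ltn_eqF h) addr0.
apply: le_trans (ED _ _ _) _; rewrite (Eind _ (fun i => i < n)%N) (Eind _ (fun i => i == n)).
have -> : count (fun i => i == n) (iota 0 n.+1) = 1%N.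
  by rewrite (count_uniq_mem n (iota_uniq _ _)) mem_iota add0n ltnSn.
rewrite E1 lerD2r; have -> : count (fun i => i < n)%N (iota 0 n.+1) = n; last by [].
rewrite -addn1 iotaD count_cat /= add0n ltnn addn0 addn0.
rewrite (@eq_in_count _ _ predT) ?count_predT ?size_iota // => i.
by rewrite mem_iota add0n.
Qed.

Lemma fundamental_gt0 n : (0 < n)%N -> 0 < fundamental n.
Proof.
move=> n0; have := @Ecoef n (fun=> 1) 0 n0; rewrite normr1 => h.
by rewrite -(pmulr_rgt0 _ C0); apply: lt_le_trans h.
Qed.

Lemma fundamentalM m n : fundamental (m * n) <= K * fundamental m * fundamental n /\ fundamental m * fundamental n <= K * fundamental (m * n).
Proof.
have -> : fundamental (m * n) = E (m * n) (tens n (fun=> 1) (fun=> 1)).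
  by apply: Eext => i _; rewrite /tens mulr1.
by split; [exact: Kup|exact: Klo].
Qed.

(** Along powers of 2 the logarithm of [fundamental] is additive up to [ln K], hence linear up to
    [ln K]; monotonicity up to [D] takes care of the other integers. *)
Lemma fundamental_growth : exists al A, [/\ 0 <= al <= 1, 0 < A &
  forall n, (0 < n)%N -> fundamental n <= A * n%:R `^ al /\ n%:R `^ al <= A * fundamental n].
Proof.
have l2 j : 0 < fundamental (2 ^ j) by apply: fundamental_gt0; rewrite expn_gt0.
pose psi j := ln (fundamental (2 ^ j)).
have [al' Hal'] : exists al', forall j, `|psi j - j%:R * al'| <= ln K.
  apply: quasi_additive => i j; rewrite /psi expnD.
  have [h1 h2] := fundamentalM (2 ^ i) (2 ^ j).
  have lij : 0 < fundamental (2 ^ i * 2 ^ j) by rewrite -expnD.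
  move: h1 h2; rewrite -ler_ln ?posrE ?mulr_gt0 // lnM ?posrE ?mulr_gt0 //.
  rewrite lnM ?posrE // => h1.
  rewrite -ler_ln ?posrE ?mulr_gt0 // lnM ?posrE // lnM ?posrE // => h2.
  rewrite ler_norml; apply/andP; split; lra.
have up j : fundamental (2 ^ j) <= K * expR (j%:R * al').
  rewrite -[leLHS]lnK ?posrE // -[K]lnK ?posrE // -expRD ler_expR.
  have := Hal' j; rewrite ler_distl -/(psi j) => /andP[_]; lra.
have lo j : expR (j%:R * al') <= K * fundamental (2 ^ j).
  rewrite -[fundamental _]lnK ?posrE // -{1}[K]lnK ?posrE // -expRD ler_expR.
  have := Hal' j; rewrite ler_distl -/(psi j) => /andP[h _]; lra.
have ln20 : 0 < ln 2 :> R by rewrite ln_gt0 // ltr1n.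
(* The slope lies in [[0, ln 2]] because [fundamental n] is at least [1 / C] for positive [n] and at
   most [n]. *)
have al0 : 0 <= al'.
  rewrite -oppr_le0; apply: (@arch_le0 _ _ (ln C + ln K)) => j.
  have h : 0 <= ln C + psi j.
    rewrite -lnM ?posrE // ln_ge0 //.
    have := @Ecoef (2 ^ j) (fun=> 1) 0; rewrite normr1; apply.
    by rewrite expn_gt0.
  have := Hal' j; rewrite ler_distl => /andP[_]; lra.
have al1 : al' <= ln 2.
  rewrite -subr_le0; apply: (@arch_le0 _ _ (ln K)) => j.
  have h : psi j <= j%:R * ln 2.
    have p2 : 0 < (2 ^ j)%:R :> R by rewrite ltr0n expn_gt0.
    have := fundamental_le (2 ^ j); rewrite -ler_ln ?posrE // natrX lnXn //.
    by rewrite -[_ *+ j]mulr_natl.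
  have := Hal' j; rewrite ler_distl => /andP[h2 _]; lra.
(* [al'] is the growth per doubling, so the exponent is [al' / ln 2]. [K] is the error along powers
   of 2, and [D * expR al'] is the cost of passing from [n] to a neighbouring power. *)
exists (al' / ln 2), (D * K * expR al'); split.
- by rewrite divr_ge0 ?(ltW ln20) //= ler_pdivrMr // mul1r.
- by rewrite !mulr_gt0 ?expR_gt0.
move=> n n0; set al := al' / ln 2.
have alge : 0 <= al by rewrite divr_ge0 // ltW.
have pw j : (2 ^ j)%:R `^ al = expR (j%:R * al').
  rewrite /powR natrX expf_eq0 pnatr_eq0 andbF lnXn // -[_ *+ j]mulr_natl /al.
  by congr expR; field; rewrite gt_eqF.
pose j := trunc_log 2 n.
have jl : (2 ^ j <= n)%N by exact: trunc_logP.
have jh : (n <= 2 ^ j.+1)%N by apply: ltnW; exact: trunc_log_ltn.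
have ee : expR (j.+1%:R * al') = expR al' * expR (j%:R * al').
  by rewrite -expRD -natr1 mulrDl mul1r addrC.
have e0 : 0 <= expR al' by exact: expR_ge0.
split.
  apply: le_trans (fundamental_mono jh) _; rewrite -!mulrA ler_pM2l //.
  apply: le_trans (up _) _; rewrite ler_pM2l // ee ler_wpM2l // -pw.
  by apply: ge0_ler_powR; rewrite ?nnegrE ?ler_nat.
apply: (@le_trans _ _ ((2 ^ j.+1)%:R `^ al)).
  by apply: ge0_ler_powR; rewrite ?nnegrE ?ler_nat.
rewrite pw ee; apply: (@le_trans _ _ (expR al' * (K * fundamental (2 ^ j)))).
  by rewrite ler_wpM2l.
have := fundamental_mono jl => h.
apply: (@le_trans _ _ (expR al' * (K * (D * fundamental n)))).
  by rewrite ler_wpM2l // ler_pM2l.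
by rewrite le_eqVlt; apply/orP; left; apply/eqP; ring.
Qed.

(** By the lattice property [a] is dominated by the constant vector of height [max |a i|], whose
    norm is that height times a bounded factor. *)
Lemma c0_case A : (forall n, (0 < n)%N -> fundamental n <= A) -> equiv_seq E (@c0_norm R).
Proof.
move=> HA; have A0 : 0 < A by apply: lt_le_trans (fundamental_gt0 (ltn0Sn 0)) (HA _ _).
have c0_ge n (a : nat -> R) i : (i < n)%N -> `|a i| <= c0_norm n a.
  by move=> ilt; rewrite /c0_norm; apply: (le_bigmax _ (fun i : 'I_n => `|a i|) (Ordinal ilt)).
have c0_ge0 n (a : nat -> R) : 0 <= c0_norm n a.
  by rewrite /c0_norm; elim/big_rec: _ => // i x _ x0; rewrite le_max x0 orbT.
exists (C + D * A); split; first by rewrite addr_gt0 ?mulr_gt0.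
move=> n a; apply/andP; split.
  rewrite ler_pdivrMl ?addr_gt0 ?mulr_gt0 //.
  apply: (@le_trans _ _ (C * E n a)).
    apply: bigmax_le => [|i _]; first by rewrite mulr_ge0 ?mult_ge0 // ltW.
    exact: Ecoef.
  by rewrite ler_wpM2r ?mult_ge0 // lerDl mulr_ge0 // ltW.
have [->|n0] := posnP n; first by rewrite mult_zero // mulr_ge0 // addr_ge0 ?mulr_ge0 // ltW.
apply: (@le_trans _ _ (D * E n (fun i => c0_norm n a * 1))).
  by apply: Elat => i ilt; rewrite mulr1 [leRHS]ger0_norm // c0_ge.
rewrite EZ ger0_norm // mulrCA mulrC ler_wpM2r //.
apply: (@le_trans _ _ (D * A)); first by rewrite ler_pM2l // HA.
by rewrite lerDr ltW.
Qed.

(** * Positive exponent: equivalence with [l_p] *)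

Section lp.
Variables (al A : R).
Hypothesis al01 : 0 < al <= 1.
Hypothesis A0 : 0 < A.
Hypothesis gr : forall n, fundamental n <= A * n%:R `^ al /\ n%:R `^ al <= A * fundamental n.

Let p := al^-1.
Let al0 : 0 < al. Proof. by case/andP: al01. Qed.
Let p0 : 0 < p. Proof. by rewrite invr_gt0. Qed.

(** Entry by entry the vector is within a factor 2 of [t] times the indicator of its support, and
    [r] is the size of that support. *)
Lemma lp_flat n a (t : R) : 0 < t ->
  (forall i, (i < n)%N -> a i = 0 \/ t <= `|a i| <= 2 * t) ->
  exists r : nat, [/\ t * r%:R `^ al <= lp_norm p n a, lp_norm p n a <= 2 * t * r%:R `^ al,
     t * fundamental r <= D * E n a & E n a <= D * (2 * t * fundamental r)].
Proof.
move=> t0 ha; pose P i := a i != 0.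
have t2 : 0 < 2 * t by rewrite mulr_gt0.
exists (count P (iota 0 n)); rewrite /fundamental -Eind /lp_norm /p invrK count_sum.
have rt (s : R) : 0 < s -> s * (\sum_(i < n) (P i)%:R) `^ al =
    (\sum_(i < n) s `^ al^-1 * (P i)%:R) `^ al.
  move=> s0; rewrite -mulr_sumr powRM ?powR_ge0 //; last by apply: sumr_ge0.
  by rewrite -powRrM mulVf ?gt_eqF // powRr1 // ltW.
have sge0 (F : 'I_n -> R) : (forall i, 0 <= F i) -> \sum_(i < n) F i \in Num.nneg.
  by move=> F0; rewrite nnegrE sumr_ge0.
split.
- rewrite rt //; apply: ge0_ler_powR; first exact: ltW.
  + by apply: sge0 => i; rewrite mulr_ge0 ?powR_ge0.
  + by apply: sge0 => i; rewrite powR_ge0.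
  apply: ler_sum => i _; rewrite /P; case: eqP => h; first by rewrite mulr0 powR_ge0.
  have [//|/andP[h1 _]] := ha i (ltn_ord i); rewrite mulr1.
  by apply: ge0_ler_powR; rewrite ?nnegrE ?normr_ge0 ?(ltW p0) ?(ltW t0).
- rewrite rt //; apply: ge0_ler_powR; first exact: ltW.
  + by apply: sge0 => i; rewrite powR_ge0.
  + by apply: sge0 => i; rewrite mulr_ge0 ?powR_ge0.
  apply: ler_sum => i _; rewrite /P; case: eqP => h.
    by rewrite h normr0 powR0 ?mulr0 // gt_eqF.
  have [//|/andP[_ h1]] := ha i (ltn_ord i); rewrite mulr1.
  by apply: ge0_ler_powR; rewrite ?nnegrE ?normr_ge0 ?(ltW p0) ?(ltW t2).
- rewrite -[t in t * _](gtr0_norm t0) -EZ; apply: Elat => i ilt.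
  rewrite /P; case: eqP => h; first by rewrite mulr0 normr0.
  by have [//|/andP[h1 _]] := ha i ilt; rewrite mulr1 gtr0_norm.
- rewrite -[2 * t](gtr0_norm t2) -EZ; apply: Elat => i ilt.
  rewrite /P; case: eqP => h; first by rewrite h normr0.
  by have [//|/andP[_ h1]] := ha i ilt; rewrite mulr1 [leRHS]gtr0_norm.
Qed.

Lemma lp_ge0 n (a : nat -> R) : 0 <= lp_norm p n a.
Proof. exact: powR_ge0. Qed.

Lemma lp_ext n (a b : nat -> R) : (forall i, (i < n)%N -> a i = b i) ->
  lp_norm p n a = lp_norm p n b.
Proof.
by move=> ab; rewrite /lp_norm; congr (_ `^ _); apply: eq_bigr => i _; rewrite ab.
Qed.

(** The two parts have disjoint supports, so their sums of [p]-th powers add exactly, and raising to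
    the power [al <= 1] is subadditive. *)
Lemma lp_split n (P : pred nat) a : lp_norm p n a <=
  lp_norm p n (fun i => if P i then a i else 0) + lp_norm p n (fun i => if P i then 0 else a i).
Proof.
rewrite /lp_norm {2 4 6}/p invrK; apply: le_trans (powR_subadd _ _ _); last first.
- by case/andP: al01 => /ltW -> ->.
- by apply: sumr_ge0 => i _; rewrite powR_ge0.
- by apply: sumr_ge0 => i _; rewrite powR_ge0.
rewrite -big_split /= le_eqVlt; apply/orP; left; apply/eqP; congr (_ `^ _).
apply: eq_bigr => i _; case: (P i); rewrite normr0 powR0 ?gt_eqF ?addr0 ?add0r //.
Qed.

Lemma lp_sup n (P : pred nat) a :
  lp_norm p n (fun i => if P i then a i else 0) <= 1 * lp_norm p n a.
Proof.
rewrite mul1r; apply: ge0_ler_powR; first by rewrite invr_ge0 ltW.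
- by rewrite nnegrE; apply: sumr_ge0 => i _; rewrite powR_ge0.
- by rewrite nnegrE; apply: sumr_ge0 => i _; rewrite powR_ge0.
apply: ler_sum => i _; case: (P i) => //.
by rewrite normr0 powR0 ?gt_eqF // powR_ge0.
Qed.

Lemma lp_coef n (a : nat -> R) i : (i < n)%N -> `|a i| <= lp_norm p n a.
Proof.
move=> ilt; have -> : `|a i| = (`|a i| `^ p) `^ p^-1.
  by rewrite -powRrM divff ?gt_eqF // powRr1.
apply: ge0_ler_powR; first by rewrite invr_ge0 ltW.
- by rewrite nnegrE powR_ge0.
- by rewrite nnegrE; apply: sumr_ge0 => j _; rewrite powR_ge0.
rewrite (bigD1 (Ordinal ilt)) //= lerDl; by apply: sumr_ge0 => j _; rewrite powR_ge0.
Qed.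

Lemma levels_E n a (t : R) J : 0 < t ->
  (forall i, (i < n)%N -> a i = 0 \/ t <= `|a i| <= 2 ^+ J * t) ->
  E n a <= J.+1%:R * (D * 2 * A * 1 * lp_norm p n a).
Proof.
refine (@levels R E (lp_norm p) (D * 2 * A) 1 _ _ _ _ _ n a t J).
- exact: Eext.
- move=> {}n P {}a; apply: le_trans (ED _ _ _).
  by rewrite (@Eext n a (fun i => (if P i then a i else 0) + (if P i then 0 else a i))) // => i _; case: (P i); rewrite ?addr0 ?add0r.
- exact: lp_sup.
- by rewrite !mulr_ge0 ?(ltW D0) ?(ltW A0).
move=> {}n {}a s s0 /(lp_flat s0)[r [h1 _ _ h4]]; have [g _] := gr r.
apply: le_trans h4 _; rewrite -!mulrA ler_pM2l // ler_pM2l //.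
apply: (@le_trans _ _ (s * (A * r%:R `^ al))); first by rewrite ler_pM2l.
by rewrite mulrCA ler_pM2l.
Qed.

Lemma levels_lp n a (t : R) J : 0 < t ->
  (forall i, (i < n)%N -> a i = 0 \/ t <= `|a i| <= 2 ^+ J * t) ->
  lp_norm p n a <= J.+1%:R * (2 * A * D * D * E n a).
Proof.
refine (@levels R (lp_norm p) E (2 * A * D) D _ _ _ _ _ n a t J).
- exact: lp_ext.
- exact: lp_split.
- move=> {}n P {}a; apply: Elat => i _; case: (P i) => //; by rewrite normr0.
- by rewrite !mulr_ge0 ?(ltW D0) ?(ltW A0).
move=> {}n {}a s s0 /(lp_flat s0)[r [_ h2 h3 _]]; have [_ g] := gr r.
apply: le_trans h2 _; rewrite -!mulrA ler_pM2l //.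
apply: (@le_trans _ _ (s * (A * fundamental r))); first by rewrite ler_pM2l.
by rewrite mulrCA ler_pM2l.
Qed.

(** Ranges multiply, so [r] factors spanning [J] dyadic levels each span [J * r] levels: linear in
    [r], although there are [n ^ r] entries. *)
Lemma tpow_levels n (a : nat -> R) (t : R) J r : 0 < t ->
  (forall i, (i < n)%N -> a i = 0 \/ t <= `|a i| <= 2 ^+ J * t) ->
  forall i, (i < n ^ r)%N -> tpow n a r i = 0 \/ t ^+ r <= `|tpow n a r i| <= 2 ^+ (J * r) * t ^+ r.
Proof.
move=> t0 ha; elim: r => [|r IH] i.
  by move=> _; right; rewrite muln0 !expr0 normr1 mulr1 lexx.
rewrite expnS => /divmod_lt[h1 h2] /=; rewrite /tens.
have [->|/andP[a1 a2]] := ha _ h1; first by left; rewrite mul0r.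
have [->|/andP[b1 b2]] := IH _ h2; first by left; rewrite mulr0.
right; rewrite normrM exprS ler_pM ?exprn_ge0 ?(ltW t0) //=.
rewrite mulnS exprD mulrACA ler_pM //.
Qed.

Lemma tpow_E n (a : nat -> R) r : E n a ^+ r <= K ^+ r * E (n ^ r) (tpow n a r) /\
  E (n ^ r) (tpow n a r) <= K ^+ r * E n a ^+ r.
Proof.
have Ka0 := mult_ge0 n a; have Kp s : 0 <= K ^+ s by rewrite exprn_ge0 // ltW.
elim: r => [|r [IH1 IH2]]; first by rewrite expn0 /= E1 !expr0 !mulr1.
rewrite !exprS expnS /=; split.
  apply: (@le_trans _ _ (E n a * (K ^+ r * E (n ^ r) (tpow n a r)))).
    by rewrite ler_wpM2l.
  have := ler_wpM2l (Kp r) (Klo n a (n ^ r) (tpow n a r)); set x := E (n ^ r) _; set y := E (n * n ^ r) _ => h.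
  have -> : E n a * (K ^+ r * x) = K ^+ r * (E n a * x) by ring.
  by have -> : K * K ^+ r * y = K ^+ r * (K * y) by ring.
apply: le_trans (Kup _ _ _ _) _; rewrite [leRHS]mulrACA ler_wpM2l //.
by rewrite mulr_ge0 // ltW.
Qed.

Lemma tpow_lp n (a : nat -> R) r : (0 < n)%N ->
  lp_norm p (n ^ r) (tpow n a r) = lp_norm p n a ^+ r.
Proof.
move=> n0; elim: r => [|r IH].
  by rewrite expn0 /lp_norm big_ord1 /= normr1 !powR1 expr0.
rewrite exprS -IH expnS /lp_norm -powRM //; last first.
- by apply: sumr_ge0 => i _; rewrite powR_ge0.
- by apply: sumr_ge0 => i _; rewrite powR_ge0.
congr (_ `^ _) => /=; rewrite /tens.
rewrite (@sum_divmod _ n (n ^ r) (fun i j => `|a i * tpow n a r j| `^ p)); last first.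
  by rewrite expn_gt0 n0.
rewrite mulr_suml; apply: eq_bigr => i _; rewrite mulr_sumr.
by apply: eq_bigr => j _; rewrite normrM powRM.
Qed.

Lemma exists_levels n (a : nat -> R) : exists t J, 0 < t /\
  forall i, (i < n)%N -> a i = 0 \/ t <= `|a i| <= 2 ^+ J * t.
Proof.
have [t [t0 ht]] : exists t : R, 0 < t /\ forall i, (i < n)%N -> a i = 0 \/ t <= `|a i|.
  elim: n => [|n [t [t0 ht]]]; first by exists 1.
  have [an0|an0] := eqVneq (a n) 0.
    exists t; split=> // i; rewrite ltnS leq_eqVlt => /orP[/eqP->|/ht//]; by left.
  exists (Num.min t `|a n|); split; first by rewrite lt_min t0 normr_gt0.
  move=> i; rewrite ltnS leq_eqVlt => /orP[/eqP->|/ht[->|h]]; [right|by left|right].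
    by rewrite ge_min lexx orbT.
  by rewrite ge_min h.
pose B := \sum_(i < n) `|a i|; pose J := Num.truncn (B / t).
exists t, J.+1; split=> // i ilt; have [->|h] := ht i ilt; [by left|right].
rewrite h /=; apply: (@le_trans _ _ B).
  by rewrite /B (bigD1 (Ordinal ilt)) //= lerDl sumr_ge0.
rewrite -ler_pdivrMr //; apply: le_trans (ltW (truncnS_gt _)) _.
by rewrite -natrX ler_nat ltnW // ltn_expl.
Qed.

(** The equivalence constant is [K] itself. The [r]-th power of the quotient of the two norms,
    divided by [K], is at most linear in [r], so [exp_le_linear] removes the constants of the level
    comparison. *)
Lemma lp_equiv : equiv_seq E (lp_norm p).
Proof.
exists K; split=> // n a; rewrite ler_pdivrMl //.
have [->|n0] := posnP n.
  by rewrite mult_zero // mulr0 /lp_norm big_ord0 powR0 ?mulr0 ?lexx // invr_eq0 gt_eqF.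
have := lp_ge0 n a; rewrite le_eqVlt => /orP[/eqP lp0|lpp].
  have a0 i : (i < n)%N -> a i = 0.
    by move=> /(lp_coef a); rewrite -lp0 normr_le0 => /eqP.
  by rewrite mult_zero // -lp0 !mulr0 lexx.
have Ep : 0 < E n a.
  rewrite lt_neqAle mult_ge0 andbT eq_sym; apply/eqP => Ea0.
  move: lpp; rewrite /lp_norm big1 ?powR0 ?invr_eq0 ?gt_eqF ?ltxx // => i _.
  have := Ecoef a (ltn_ord i); rewrite Ea0 mulr0 normr_le0 => /eqP->.
  by rewrite normr0 powR0 ?gt_eqF.
have [t [J [t0 ht]]] := exists_levels n a.
have lev r := tpow_levels (r := r) t0 ht.
have tr0 r : 0 < t ^+ r by rewrite exprn_gt0.
have Kr0 r : 0 < K ^+ r by rewrite exprn_gt0.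
have JE (B : R) r : (J * r).+1%:R * B = B + (B * J%:R) * r%:R.
  by rewrite -natr1 natrM; ring.
apply/andP; split.
  set B := 2 * A * D * D; have B0 : 0 <= B by rewrite !mulr_ge0 ?(ltW A0) ?(ltW D0).
  have x0 : 0 < lp_norm p n a / (K * E n a) by rewrite divr_gt0 // mulr_gt0.
  rewrite -[leRHS]mul1r -ler_pdivrMr ?mulr_gt0 //.
  apply: (exp_le_linear (ltW x0) B0 (mulr_ge0 B0 (ler0n _ J))) => r.
  rewrite -JE expr_div_n ler_pdivrMr ?exprn_gt0 ?mulr_gt0 //.
  rewrite -tpow_lp //; apply: le_trans (levels_lp (tr0 r) (lev r)) _.
  rewrite -/B mulrA exprMn ler_wpM2l ?(mulr_ge0 (ler0n _ _) B0) //.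
  by have [] := tpow_E n a r.
set B := D * 2 * A * 1; have B0 : 0 <= B by rewrite !mulr_ge0 ?(ltW A0) ?(ltW D0).
have x0 : 0 < E n a / (K * lp_norm p n a) by rewrite divr_gt0 // mulr_gt0.
rewrite -[leRHS]mul1r -ler_pdivrMr ?mulr_gt0 //.
apply: (exp_le_linear (ltW x0) B0 (mulr_ge0 B0 (ler0n _ J))) => r.
rewrite -JE expr_div_n ler_pdivrMr ?exprn_gt0 ?mulr_gt0 //.
have [h _] := tpow_E n a r; apply: le_trans h _.
rewrite exprMn mulrCA ler_pM2l // -tpow_lp //.
by apply: le_trans (levels_E (tr0 r) (lev r)) _; rewrite -/B mulrA.
Qed.

End lp.

Theorem multiplicative_c0_lp : equiv_seq E (@c0_norm R) \/
  exists p, 1 <= p /\ equiv_seq E (lp_norm p).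
Proof.
have [al [A [/andP[al0 al1] A0 gr]]] := fundamental_growth.
move: al0; rewrite le_eqVlt => /orP[/eqP al0|al0].
  left; apply: (@c0_case A) => n n0; have [h _] := gr n n0.
  by move: h; rewrite -al0 powRr0 mulr1.
right; exists al^-1; split; first by rewrite invf_ge1.
apply: (@lp_equiv al A) => //; first by rewrite al0.
(* At length 0 both sides vanish since [al > 0]; for [al = 0] the power of 0 would be 1, which is
   why [fundamental_growth] assumes a positive length. *)
move=> [|n]; last exact: gr.
by rewrite /fundamental mult_zero // powR0 ?gt_eqF // mulr0.
Qed.

End multiplicative.

(** * Norming functionals in finite dimension *)

Section sublinear.
Variables (R : realType) (V : lmodType R).

Definition sublinear (q : V -> R) : Prop :=
  [/\ forall u v, q (u + v) <= q u + q v,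
      forall (t : R) u, 0 < t -> q (t *: u) <= t * q u & q 0 = 0].

Lemma sublinear_opp q u : sublinear q -> - q (- u) <= q u.
Proof. by move=> [D _ Z]; have := D u (- u); rewrite subrr Z; lra. Qed.

Lemma sublinearZ q (t : R) u : sublinear q -> 0 <= t -> q (t *: u) = t * q u.
Proof.
move=> [D Z Z0]; rewrite le_eqVlt => /orP[/eqP<-|t0].
  by rewrite scale0r mul0r.
apply/eqP; rewrite eq_le Z //= -ler_pdivlMl //.
by apply: le_trans (Z _ _ _); rewrite ?invr_gt0 // scalerA mulVf ?gt_eqF // scale1r.
Qed.

(** From [- q' w <= q' (- w) <= q (- w) = - q w]: where [q] is already odd, a smaller sublinear
    functional cannot change its value. Successive corrections thus preserve the earlier ones. *)
Lemma sublinear_squeeze q q' w : sublinear q' -> (forall u, q' u <= q u) ->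
  q (- w) = - q w -> q' w = q w /\ q' (- w) = - q' w.
Proof.
move=> sq' le odd; have h1 := sublinear_opp w sq'; have h2 := le w; have h3 := le (- w).
by split; lra.
Qed.

(** Witness: [q' u := inf_(t >= 0) (q (u + t v) - t q v)]. *)
Lemma sublinear_odd_step q v : sublinear q -> exists q',
  [/\ sublinear q', forall u, q' u <= q u, q' v = q v & q' (- v) = - q' v].
Proof.
move=> sq; have [D Z Z0] := sq.
pose A u := [set q (u + t *: v) - t * q v | t in [set t : R | 0 <= t]].
have lbA u : lbound (A u) (- q (- u)).
  move=> _ [t /= t0 <-]; have := D (u + t *: v) (- u).
  by rewrite addrAC subrr add0r (sublinearZ _ sq t0); lra.
have neA u : A u !=set0 by exists (q (u + 0 *: v) - 0 * q v); exists 0 => /=.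
have hiA u : has_inf (A u) by split=> //; exists (- q (- u)).
pose q' u := inf (A u).
have q'le u t : 0 <= t -> q' u <= q (u + t *: v) - t * q v.
  by move=> t0; apply: ge_inf; [exact: (hiA u).2|exists t].
have sq' : sublinear q'.
  split.
  - move=> u w; apply/ler_addgt0Pr => e e0.
    have e2 : 0 < e / 2 by rewrite divr_gt0.
    have [_ [t /= t0 <-] ht] := inf_adherent e2 (hiA u).
    have [_ [s /= s0 <-] hs] := inf_adherent e2 (hiA w).
    have := @q'le (u + w) (t + s) (addr_ge0 t0 s0).
    have := D (u + t *: v) (w + s *: v).
    rewrite addrACA -scalerDl -/(q' u) -/(q' w) in ht hs *; lra.
  - move=> t u t0; rewrite -ler_pdivrMl //; apply: lb_le_inf => // _ [s /= s0 <-].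
    rewrite ler_pdivrMl //; apply: le_trans (q'le _ (t * s) _) _.
      by rewrite mulr_ge0 // ltW.
    rewrite -scalerA -scalerDr mulrBr mulrA lerB //.
    exact: Z.
  - apply/eqP; rewrite eq_le; apply/andP; split.
      by have := q'le 0 0 (lexx 0); rewrite scale0r addr0 Z0 mul0r subrr.
    apply: lb_le_inf => // _ [s /= s0 <-].
    by rewrite add0r (sublinearZ _ sq s0) subrr.
have le u : q' u <= q u.
  by have := q'le u 0 (lexx 0); rewrite scale0r addr0 mul0r subr0.
have h1 : q' (- v) <= - q v.
  by have := q'le (- v) 1 ler01; rewrite scale1r addNr Z0 mul1r sub0r.
have h2 := sublinear_opp v sq'; have h3 := le v.
by exists q'; split=> //; lra.
Qed.

Lemma sublinear_odd_seq q (ws : seq V) : sublinear q -> exists q',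
  [/\ sublinear q', forall u, q' u <= q u & forall w, w \in ws -> q' (- w) = - q' w].
Proof.
move=> sq; elim: ws => [|w ws [q1 [s1 le1 odd1]]]; first by exists q.
have [q2 [s2 le2 _ odd2]] := sublinear_odd_step w s1.
exists q2; split=> // [u|w']; first exact: le_trans (le1 u).
rewrite inE => /orP[/eqP->//|/odd1 h].
by have [] := sublinear_squeeze s2 le2 h.
Qed.

End sublinear.

(** Hahn-Banach in finite dimension: a sublinear functional that is odd at every unit vector lies
    below a linear one, and opposite vectors give equality. Making it odd at [a] first freezes its
    value there. *)
Lemma norming (R : realType) (E : nat -> (nat -> R) -> R) n (a : nat -> R) :
  (forall a b, (forall i, (i < n)%N -> a i = b i) -> E n a = E n b) ->
  (forall a b, E n (fun i => a i + b i) <= E n a + E n b) ->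
  (forall t a, E n (fun i => t * a i) = `|t| * E n a) ->
  exists s : nat -> R, \sum_(i < n) a i * s i = E n a /\
    forall c : nat -> R, \sum_(i < n) c i * s i <= E n c.
Proof.
move=> ext D Z; pose q (p : {poly R}) := E n (fun i => p`_i).
have sq : sublinear q.
  split.
  - move=> u v; apply: le_trans (D _ _); rewrite /q.
    by rewrite (@ext _ (fun i => u`_i + v`_i)) // => i _; rewrite coefD.
  - move=> t u t0; rewrite /q (@ext _ (fun i => t * u`_i)) ?Z ?gtr0_norm //.
    by move=> i _; rewrite coefZ.
  - rewrite /q (@ext _ (fun i => 0 * 0)) ?Z ?normr0 ?mul0r //.
    by move=> i _; rewrite coef0 ?mul0r.
pose vec (c : nat -> R) : {poly R} := \poly_(i < n) c i.
have qvec c : q (vec c) = E n c.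
  by apply: ext => i ilt; rewrite coef_poly ilt.
have [q1 [s1 le1 qa odda]] := sublinear_odd_step (vec a) sq.
have [q2 [s2 le2 odd2]] := sublinear_odd_seq [seq 'X^i | i <- iota 0 n] s1.
have [q2a _] := sublinear_squeeze s2 le2 odda.
pose s i := q2 'X^i.
have up c : q2 (vec c) <= \sum_(i < n) c i * s i.
  have [q2D _ q20] := s2.
  rewrite /vec poly_def; apply: (@le_trans _ _ (\sum_(i < n) q2 (c i *: 'X^i))).
    elim/big_rec2: _ => [|i y x _ h]; first by rewrite q20.
    by apply: le_trans (q2D _ _) _; rewrite lerD2l.
  apply: ler_sum => i _; have [c0|c0] := leP 0 (c i).
    by rewrite (sublinearZ _ s2 c0).
  have -> : c i *: 'X^i = (- c i) *: (- 'X^i) :> {poly R} by rewrite scalerN scaleNr opprK.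
  rewrite (sublinearZ _ s2); last by rewrite oppr_ge0 ltW.
  rewrite odd2; first by rewrite mulrNN.
  by apply/mapP; exists (i : nat) => //; rewrite mem_iota add0n ltn_ord.
have low (c : nat -> R) : \sum_(i < n) c i * s i <= q2 (vec c).
  have := up (fun i => - c i); have -> : vec (fun i => - c i) = - vec c.
    by apply/polyP => i; rewrite coefN !coef_poly; case: ifP; rewrite ?oppr0.
  under eq_bigr do rewrite mulNr; rewrite sumrN.
  by have := sublinear_opp (vec c) s2; lra.
exists s; split=> [|c].
  by apply/eqP; rewrite -(qvec a) -qa -q2a eq_le low up.
by apply: le_trans (low c) _; rewrite -qvec; apply: le_trans (le2 _) (le1 _).
Qed.

(** * Reflexive spaces with a Schreier unconditional basis *)

Lemma cvg_seqP (R : realType) (V : normedModType R) (s : nat -> V) (x : V) :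
  s @ \oo --> x <->
  forall e : R, 0 < e -> exists N, forall n, (N <= n)%N -> `|x - s n| <= e.
Proof.
rewrite cvgrPdist_le; split=> H e e0.
  by have [N _ HN] := H e e0; exists N => n Nn; exact: HN.
by have [N HN] := H e e0; exists N => // n /=; exact: HN.
Qed.

Section ulim_lemmas.
Variables (R : realType) (U : set_system nat).
Hypothesis UU : UltraFilter U.

Lemma ulim_uniq (f : nat -> R) (B l : R) : (forall k, `|f k| <= B) ->
  (forall e, 0 < e -> U [set k | `|f k - l| <= e]) -> ulim U f = l.
Proof.
move=> fB H; have PU := ultra_proper.
apply/eqP; rewrite -subr_eq0 -normr_le0; apply/ler_addgt0Pl => e e0; rewrite addr0.
have e2 : 0 < e / 2 by rewrite divr_gt0.
have [k /= [h1 h2]] := filter_ex (filterI (ulimP UU fB e2) (H _ e2)).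
have -> : ulim U f - l = (f k - l) - (f k - ulim U f) by ring.
apply: le_trans (ler_normB _ _) _; lra.
Qed.

Lemma ulim_lin (a B : R) (f g : nat -> R) :
  (forall k, `|f k| <= B) -> (forall k, `|g k| <= B) ->
  ulim U (fun k => a * f k + g k) = a * ulim U f + ulim U g.
Proof.
move=> fB gB; have PU := ultra_proper.
apply: (@ulim_uniq _ (`|a| * B + B)) => [k|e e0].
  apply: le_trans (ler_normD _ _) _; rewrite normrM lerD //.
  by rewrite ler_wpM2l.
have e2 : 0 < e / (1 + `|a|) by rewrite divr_gt0 // ltr_pwDl.
apply: filterS (filterI (ulimP UU fB e2) (ulimP UU gB e2)) => k /= [h1 h2].
have -> : a * f k + g k - (a * ulim U f + ulim U g) =
  a * (f k - ulim U f) + (g k - ulim U g) by ring.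
apply: le_trans (ler_normD _ _) _; rewrite normrM.
have h3 : `|a| * `|f k - ulim U f| <= `|a| * (e / (1 + `|a|)) by rewrite ler_wpM2l.
apply: le_trans (lerD h3 h2) _.
have -> : `|a| * (e / (1 + `|a|)) + e / (1 + `|a|) = e; last by [].
by field; rewrite gt_eqF // ltr_pwDl.
Qed.

Lemma ulim_bound (f : nat -> R) (B : R) : (forall k, `|f k| <= B) -> `|ulim U f| <= B.
Proof.
move=> fB; have PU := ultra_proper; apply/ler_addgt0Pr => e e0.
have [k /= hk] := filter_ex (ulimP UU fB e0).
have -> : ulim U f = f k - (f k - ulim U f) by ring.
by apply: le_trans (ler_normB _ _) _; rewrite lerD.
Qed.

End ulim_lemmas.

Section poly_comb.
Variables (R : realType) (V : lmodType R) (f : nat -> V).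

Definition poly_comb (p : {poly R}) : V := \sum_(i < size p) p`_i *: f i.

Lemma poly_combE n (p : {poly R}) : (size p <= n)%N ->
  poly_comb p = \sum_(i < n) p`_i *: f i.
Proof.
move=> /subnKC <-; rewrite big_split_ord /= [X in _ = _ + X]big1 ?addr0 // => i _.
by rewrite nth_default ?scale0r // leq_addr.
Qed.

Lemma poly_combD p q : poly_comb (p + q) = poly_comb p + poly_comb q.
Proof.
pose n := maxn (size p) (size q).
rewrite (@poly_combE n (p + q)) ?size_polyD // (@poly_combE n p) ?leq_maxl //.
rewrite (@poly_combE n q) ?leq_maxr // -big_split /=.
by apply: eq_bigr => i _; rewrite coefD scalerDl.
Qed.

Lemma poly_combZ c p : poly_comb (c *: p) = c *: poly_comb p.
Proof.
rewrite (@poly_combE (size p)) ?size_scale_leq // scaler_sumr.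
by apply: eq_bigr => i _; rewrite coefZ scalerA.
Qed.

Lemma poly_comb_sum (I : Type) (r : seq I) (P : pred I) (p : I -> {poly R}) :
  poly_comb (\sum_(i <- r | P i) p i) = \sum_(i <- r | P i) poly_comb (p i).
Proof.
elim/big_rec2: _ => [|i y x _ <-]; last by rewrite poly_combD.
by rewrite /poly_comb size_poly0 big_ord0.
Qed.

Lemma poly_combX i : poly_comb 'X^i = f i.
Proof.
rewrite /poly_comb size_polyXn (bigD1 ord_max) //= coefXn eqxx scale1r.
rewrite big1 ?addr0 // => j jn; rewrite coefXn.
by case: eqP => [h|_]; rewrite ?scale0r //; case/negP: jn; apply/eqP/val_inj.
Qed.

Variables (S : set V) (N : V -> R).
Hypothesis SC : forall p, S (poly_comb p).
Hypothesis weak_null : forall y : nat -> {poly R}, vanishing y ->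
  (forall k, N (poly_comb (y k)) = 1) ->
  forall Phi, bdd_functional S N Phi -> Phi \o (poly_comb \o y) @ \oo --> (0 : R).

Lemma vanishing_normalized (y : nat -> {poly R}) : vanishing y ->
  (forall k, N (poly_comb (y k)) = 1) -> normalized_weakly_null S N (poly_comb \o y).
Proof.
by move=> yv y1; split=> [n|]; [exact: SC|split=> // Phi hPhi; exact: weak_null].
Qed.

Lemma generates_comb y (W : normedModType R) (xt : nat -> W) :
  generates_spreading_model (N \o poly_comb) y xt ->
  generates_spreading_model N (poly_comb \o y) xt.
Proof.
move=> [eps [h1 [h2 h3]]]; exists eps; split=> //; split=> // n a k a1 kinc nk.
have := h3 n a k a1 kinc nk; rewrite /=.
have -> // : poly_comb (\sum_(i < n) a i *: y (k i)) = \sum_(i < n) a i *: poly_comb (y (k i)).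
by rewrite poly_comb_sum; apply: eq_bigr => i _; rewrite poly_combZ.
Qed.

Lemma unique_sm_comb : SPw_single S N -> unique_spreading_model (N \o poly_comb).
Proof.
move=> [_ H] x1 W1 xt1 x2 W2 xt2 v1 n1 g1 v2 n2 g2.
apply: (H (poly_comb \o x1) W1 xt1 (poly_comb \o x2) W2 xt2).
- exact: vanishing_normalized.
- exact: generates_comb.
- exact: vanishing_normalized.
- exact: generates_comb.
Qed.

End poly_comb.

(** * The basis and its coordinate functionals *)

Section basis.
Variables (R : realType) (X : normedModType R) (e : nat -> X) (C : R).
Variable cf : X -> nat -> R.
Hypothesis cf_cvg : forall x, (fun n => \sum_(i < n) cf x i *: e i) @ \oo --> x.
Hypothesis cf_uniq : forall x (a : nat -> R),
  (fun n => \sum_(i < n) a i *: e i) @ \oo --> x -> a = cf x.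
Hypothesis e1 : forall i, `|e i| = 1.
Hypothesis SUe : schreier_unconditional e C.

Lemma coef_lin t x y i : cf (t *: x + y) i = t * cf x i + cf y i.
Proof.
rewrite -(@cf_uniq _ (fun i => t * cf x i + cf y i)) //.
have -> : (fun n => \sum_(i < n) (t * cf x i + cf y i) *: e i) =
  (fun n => t *: (\sum_(i < n) cf x i *: e i) + \sum_(i < n) cf y i *: e i).
  apply/funext => n; rewrite scaler_sumr -big_split /=.
  by apply: eq_bigr => j _; rewrite scalerDl scalerA.
by apply: cvgD; [apply: cvgZl_tmp|]; exact: cf_cvg.
Qed.

Lemma cf_finite n (a : nat -> R) : (forall i, (n <= i)%N -> a i = 0) ->
  cf (\sum_(i < n) a i *: e i) = a.
Proof.
move=> a0; apply/esym/cf_uniq/cvg_seqP => d d0; exists n => k /subnKC <-.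
rewrite big_split_ord /= [X in _ - (_ + X)]big1 ?addr0 ?subrr ?normr0 ?ltW // => i _.
by rewrite a0 ?scale0r // leq_addr.
Qed.

Lemma cf_comb p : cf (poly_comb e p) = fun i => p`_i.
Proof. by apply: cf_finite => i h; rewrite nth_default. Qed.

Lemma C_ge1 : 1 <= C.
Proof.
have := @SUe 1%N (fun=> 1) [:: 0%N] (schreier_single 0).
by rewrite big_mkcond !big_ord1 /= scale1r e1 mulr1.
Qed.

(** A long partial sum of the expansion of [x] covers [F] and has norm close to that of [x]; the
    finite inequality is applied to it. *)
Lemma schreier_proj F x : schreier1 F -> `|\sum_(i <- F) cf x i *: e i| <= C * `|x|.
Proof.
move=> sF; have C0 : 0 < C by exact: lt_le_trans C_ge1.
have Fsum n : (forall i, i \in F -> (i < n)%N) ->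
    \sum_(i <- F) cf x i *: e i = \sum_(i < n | (i : nat) \in F) cf x i *: e i.
  move=> hn; rewrite -(big_mkord (fun i => i \in F) (fun i => cf x i *: e i)).
  rewrite -big_filter; apply: perm_big; apply: uniq_perm.
  - by case: sF.
  - by rewrite filter_uniq // iota_uniq.
  - move=> i; rewrite mem_filter mem_index_iota /=.
    by case iF: (i \in F) => //=; rewrite hn.
apply/ler_addgt0Pr => d d0.
have dC : 0 < d / C by rewrite divr_gt0.
have [N HN] := (cvg_seqP _ _).1 (@cf_cvg x) _ dC.
pose n := maxn N (\max_(i <- F) i).+1.
rewrite (Fsum n); last first.
  move=> i iF; rewrite leq_max; apply/orP; right; rewrite ltnS.
  exact: (@leq_bigmax_seq _ F xpredT id i iF isT).
apply: le_trans (SUe n (cf x) sF) _.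
have := HN n (leq_maxl _ _) => h.
have h2 : `|\sum_(i < n) cf x i *: e i| <= `|x| + d / C.
  rewrite -[X in `|X|](subKr x); apply: le_trans (ler_normB _ _) _.
  by rewrite lerD.
apply: le_trans (ler_wpM2l (ltW C0) h2) _.
by rewrite mulrDr [C * (d / C)]mulrC divfK ?gt_eqF.
Qed.

Lemma cf_bound x i : `|cf x i| <= C * `|x|.
Proof.
have := schreier_proj x (schreier_single i).
by rewrite big_seq1 normrZ e1 mulr1.
Qed.

Lemma cf_proj F x i : uniq F ->
  cf (\sum_(j <- F) cf x j *: e j) i = if i \in F then cf x i else 0.
Proof.
move=> uF; have -> : \sum_(j <- F) cf x j *: e j =
   poly_comb e (\sum_(j <- F) cf x j *: 'X^j).
  by rewrite poly_comb_sum; apply: eq_bigr => j _; rewrite poly_combZ poly_combX.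
rewrite cf_comb coef_sum; case: ifP => iF.
  rewrite (bigD1_seq i) //= coefZ coefXn eqxx mulr1 big1 ?addr0 // => j ji.
  by rewrite coefZ coefXn eq_sym (negPf ji) mulr0.
rewrite big_seq big1 // => j jF; rewrite coefZ coefXn.
by case: eqP => [h|_]; rewrite ?mulr0 //; move: iF; rewrite h jF.
Qed.

Definition normX (p : {poly R}) : R := `|poly_comb e p|.

Lemma normX_seminorm : seminorm normX.
Proof.
split=> [p q|c p]; rewrite /normX ?poly_combD ?poly_combZ ?normrZ //.
exact: ler_normD.
Qed.

Lemma normX_X i : normX 'X^i = 1.
Proof. by rewrite /normX poly_combX. Qed.

Lemma normX_schreier F p : schreier1 F -> normX (restr F p) <= C * normX p.
Proof.
move=> sF; have := SUe (size p) (fun i => p`_i) sF; rewrite /normX.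
have -> // : poly_comb e (restr F p) = \sum_(i < size p | (i : nat) \in F) p`_i *: e i.
rewrite (@poly_combE _ _ _ (size p)) ?size_poly // [RHS]big_mkcond.
by apply: eq_bigr => i _; rewrite coef_restr; case: ifP => //; rewrite scale0r.
Qed.

Definition coordf i : X -> R^o := fun x => cf x i.

Lemma dual_normP (f : X -> R^o) (x : X) : dual_set f -> `|f x| <= dual_norm f * `|x|.
Proof.
move=> [lin [B HB]].
have fZ t y : f (t *: y) = t * f y.
  have f0 : f 0 = 0.
    by have := lin 1 0 0 I I; rewrite scale1r addr0 mul1r; lra.
  by rewrite -[t *: y]addr0 lin // f0 addr0.
have hs : has_sup [set `|f x| | x in [set x : X | `|x| <= 1]].
  split; first by exists `|f 0|; exists 0 => //=; rewrite normr0.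
  exists `|B| => _ [y /= y1 <-]; apply: le_trans (HB y I) _.
  apply: le_trans (ler_wpM2r (normr_ge0 y) (ler_norm B)) _.
  by rewrite ler_piMr.
have [x0|x0] := eqVneq x 0.
  by rewrite x0 -(scale0r (0 : X)) fZ mul0r !normr0 scale0r normr0 mulr0.
have nx0 : 0 < `|x| by rewrite normr_gt0.
rewrite -ler_pdivrMr //; have -> : `|f x| / `|x| = `|f (`|x|^-1 *: x)|.
  by rewrite fZ normrM normfV normr_id mulrC.
apply: ub_le_sup; first by case: hs.
exists (`|x|^-1 *: x) => //=.
by rewrite normrZ normfV normr_id mulVf // gt_eqF.
Qed.

Lemma dual_norm_le (f : X -> R^o) (B : R) : 0 <= B ->
  (forall x, `|f x| <= B * `|x|) -> dual_norm f <= B.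
Proof.
move=> B0 H; apply: ge_sup; first by exists `|f 0|; exists 0 => //=; rewrite normr0.
move=> _ [x /= x1 <-]; apply: le_trans (H x) _; by rewrite ler_piMr.
Qed.

Lemma dual_set_lin t (f g : X -> R^o) : dual_set f -> dual_set g -> dual_set (t *: f + g).
Proof.
move=> [lf [B1 H1]] [lg [B2 H2]]; split.
  move=> a u v _ _; rewrite !fctE /= lf // lg //.
  by rewrite /GRing.scale /=; ring.
exists (`|t| * B1 + B2) => u _; rewrite !fctE /=.
apply: le_trans (ler_normD _ _) _; rewrite mulrDl lerD ?H2 //.
by rewrite normrZ -mulrA ler_wpM2l // H1.
Qed.

Lemma dual_set0 : dual_set (0 : X -> R^o).
Proof.
have -> : (0 : X -> R^o) = (fun=> 0) by [].
split=> [a u v _ _|]; first by rewrite mulr0 addr0.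
by exists 0 => u _; rewrite normr0 mul0r.
Qed.

Lemma coordf_dual i : dual_set (coordf i).
Proof.
split; first by move=> a u v _ _; exact: coef_lin.
by exists C => u _; exact: cf_bound.
Qed.

Definition coordf_norm i : R := dual_norm (coordf i).

Lemma coordf_norm_bounds i : 1 <= coordf_norm i <= C.
Proof.
apply/andP; split; last by apply: dual_norm_le (cf_bound ^~ i); exact: le_trans C_ge1.
have := dual_normP (e i) (coordf_dual i); rewrite e1 mulr1 /coordf.
have -> : cf (e i) i = 1 by rewrite -(poly_combX e i) cf_comb coefXn eqxx.
by rewrite normr1.
Qed.

Lemma coordf_norm_gt0 i : 0 < coordf_norm i.
Proof. by have /andP[h _] := coordf_norm_bounds i; apply: lt_le_trans h. Qed.

(** Uniqueness in the dual concerns normalized sequences, hence the division; by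
    [coordf_norm_bounds] it changes coefficients by at most a factor [C]. *)
Definition ncoordf i : X -> R^o := (coordf_norm i)^-1 *: coordf i.

Lemma comb_ncoordfE n (p : {poly R}) x : (size p <= n)%N ->
  poly_comb ncoordf p x = \sum_(i < n) p`_i * ((coordf_norm i)^-1 * cf x i).
Proof. by move=> /poly_combE ->; rewrite fct_sumE. Qed.

Lemma comb_ncoordf_dual p : dual_set (poly_comb ncoordf p).
Proof.
rewrite /poly_comb; elim/big_rec: _ => [|i f _ hf]; first exact: dual_set0.
apply: dual_set_lin => //; rewrite -[ncoordf i]addr0.
by apply: dual_set_lin; [exact: coordf_dual|exact: dual_set0].
Qed.

Definition normD (p : {poly R}) : R := dual_norm (poly_comb ncoordf p).

Lemma dual_norm_ge0 (f : X -> R^o) : dual_set f -> 0 <= dual_norm f.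
Proof.
by move=> df; have := dual_normP (e 0) df; rewrite e1 mulr1; exact: le_trans.
Qed.

Lemma normD_seminorm : seminorm normD.
Proof.
have ge0 p : 0 <= normD p by exact/dual_norm_ge0/comb_ncoordf_dual.
have Zle c p : normD (c *: p) <= `|c| * normD p.
  apply: dual_norm_le => [|x]; first by rewrite mulr_ge0.
  rewrite poly_combZ fctE normrZ -mulrA ler_wpM2l //.
  exact/dual_normP/comb_ncoordf_dual.
split=> [p q|c p].
  apply: dual_norm_le => [|x]; first by rewrite addr_ge0.
  rewrite poly_combD fctE; apply: le_trans (ler_normD _ _) _.
  by rewrite mulrDl lerD //; exact/dual_normP/comb_ncoordf_dual.
apply/eqP; rewrite eq_le Zle /=; have [->|c0] := eqVneq c 0.
  by rewrite normr0 mul0r.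
rewrite -ler_pdivlMl ?normr_gt0 // -normfV; apply: le_trans (Zle _ _).
by rewrite scalerA mulVf // scale1r.
Qed.

Lemma normD_X i : normD 'X^i = 1.
Proof.
rewrite /normD poly_combX /ncoordf.
have w0 := coordf_norm_gt0 i; apply/eqP; rewrite eq_le; apply/andP; split.
  apply: dual_norm_le => // x; rewrite mul1r fctE normrZ normfV (gtr0_norm w0).
  by rewrite ler_pdivrMl //; exact/dual_normP/coordf_dual.
rewrite -[leLHS](mulVf (lt0r_neq0 w0)) ler_pdivrMl //.
apply: dual_norm_le => [|x].
  rewrite mulr_ge0 ?(ltW w0) //; have := comb_ncoordf_dual 'X^i; rewrite poly_combX.
  exact: dual_norm_ge0.
have := comb_ncoordf_dual 'X^i; rewrite poly_combX => /(dual_normP x).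
rewrite fctE normrZ normfV (gtr0_norm w0) -/(ncoordf i) ler_pdivrMl //.
by rewrite mulrA.
Qed.

(** On functionals, [restr F] is the adjoint of the projection of [X] onto the coordinates in [F],
    so the constant [C] carries over. *)
Lemma normD_schreier F p : schreier1 F -> normD (restr F p) <= C * normD p.
Proof.
move=> sF; have C0 : 0 <= C by exact: le_trans C_ge1.
have d0 := dual_norm_ge0 (comb_ncoordf_dual p).
apply: dual_norm_le => [|x]; first by rewrite mulr_ge0.
have -> : poly_comb ncoordf (restr F p) x = poly_comb ncoordf p (\sum_(i <- F) cf x i *: e i).
  rewrite !(@comb_ncoordfE (size p)) ?size_poly //.
  apply: eq_bigr => i _; rewrite coef_restr cf_proj; last by case: sF.
  by case: ifP => // _; rewrite !mulr0 mul0r.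
apply: le_trans (dual_normP _ (comb_ncoordf_dual p)) _.
rewrite -/(normD p); have -> : C * normD p * `|x| = normD p * (C * `|x|) by ring.
by apply: ler_wpM2l => //; exact: schreier_proj.
Qed.

Hypothesis refl : reflexive_space X.

(** A weak cluster point of the sequence along an ultrafilter is represented by a
    vector of [X] (reflexivity), and all its coefficients vanish. *)
Lemma weak_null_X (u : nat -> X) : (forall k, `|u k| <= 1) ->
  (forall i, exists K0, forall k, (K0 <= k)%N -> cf (u k) i = 0) ->
  forall f : X -> R^o, dual_set f -> (f \o u : nat -> R) @ \oo --> (0 : R).
Proof.
move=> u1 uv f df; apply/(@cvg_seqP R R^o) => d d0; apply: contrapT => nH.
have ex j : exists k, (j <= k)%N /\ d < `|f (u k)|.
  apply: contrapT => nk; apply: nH; exists j => k jk; rewrite sub0r normrN leNgt.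
  by apply/negP => h; apply: nk; exists k.
have [k kP] := choice ex.
have [U [UU oU]] := @ultraFilterLemma nat \oo _.
have PU := ultra_proper.
pose Phi (g : X -> R^o) : R := ulim U (fun j => g (u (k j))).
have bd g : dual_set g -> forall j, `|g (u (k j))| <= dual_norm g.
  move=> dg j; apply: le_trans (dual_normP _ dg) _; rewrite ler_piMr //.
  exact: dual_norm_ge0.
have [x xP] : exists x : X, forall g, dual_set g -> Phi g = g x.
  apply: refl; split.
    move=> a g h dg dh; rewrite /Phi.
    pose B := Num.max (dual_norm g) (dual_norm h).
    apply: (@ulim_lin _ _ UU a B (fun j => g (u (k j))) (fun j => h (u (k j)))) => j.
      by apply: le_trans (bd _ dg j) _; rewrite le_max lexx.
    by apply: le_trans (bd _ dh j) _; rewrite le_max lexx orbT.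
  exists 1 => g dg; rewrite mul1r; apply: ulim_bound => //; exact: bd.
have cfx i : cf x i = 0.
  rewrite -[cf x i]/(coordf i x) -xP; last exact: coordf_dual.
  apply: (@ulim_uniq _ _ UU _ (dual_norm (coordf i))); first exact/bd/coordf_dual.
  move=> e' e'0; have [K0 HK] := uv i; apply: oU; exists K0 => // j /= Kj.
  rewrite /coordf HK ?subrr ?normr0 ?ltW //.
  by apply: leq_trans Kj _; have [] := kP j.
have x0 : x = 0.
  apply: (norm_cvg_unique (@cf_cvg x)).
  have -> : (fun n => \sum_(i < n) cf x i *: e i) = (fun=> 0).
    by apply/funext => n; rewrite big1 // => i _; rewrite cfx scale0r.
  exact: cvg_cst.
have Pf : Phi f = 0.
  rewrite xP // x0; have [lf _] := df.
  by have := lf 1 0 0 I I; rewrite scale1r addr0 mul1r; lra.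
have [j /=] := filter_ex (ulimP UU (bd _ df) d0).
rewrite -/(Phi f) Pf subr0 => h.
by have [_] := kP j; rewrite ltNge h.
Qed.

Lemma weak_null_basis (y : nat -> {poly R}) : vanishing y ->
  (forall k, normX (y k) = 1) ->
  forall Phi, bdd_functional [set: X] (fun x : X => `|x|) Phi ->
  Phi \o (poly_comb e \o y) @ \oo --> (0 : R).
Proof.
move=> yv y1 Phi hPhi; apply: (@weak_null_X (poly_comb e \o y)) => //.
  by move=> k; rewrite [leLHS]y1.
by move=> i; have [K0 HK] := yv i; exists K0 => k Kk; rewrite /= cf_comb HK.
Qed.

(** By reflexivity [Phi] is evaluation at some [x]. Late [y k] vanish on the first [N] coordinates
    and see only the tail of [x], which is small in norm. *)
Lemma weak_null_dual (y : nat -> {poly R}) : vanishing y ->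
  (forall k, normD (y k) = 1) ->
  forall Phi, bdd_functional (@dual_set R X) (@dual_norm R X) Phi ->
  Phi \o (poly_comb ncoordf \o y) @ \oo --> (0 : R).
Proof.
move=> yv y1 Phi /refl[x xP]; apply/(@cvg_seqP R R^o) => d d0.
have [N HN] := (cvg_seqP _ _).1 (@cf_cvg x) _ d0.
have [K HK] : exists K, forall k, (K <= k)%N -> forall i, (i < N)%N -> (y k)`_i = 0.
  elim: N {HN} => [|N [K HK]]; first by exists 0%N.
  have [K' HK'] := yv N; exists (maxn K K') => k; rewrite geq_max => /andP[k1 k2] i.
  rewrite ltnS leq_eqVlt => /orP[/eqP->|h]; [exact: HK'|exact: HK].
exists K => k Kk; rewrite sub0r normrN /= xP; last exact: comb_ncoordf_dual.
pose xN := \sum_(i < N) cf x i *: e i.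
have lin := (comb_ncoordf_dual (y k)).1.
have xN0 : poly_comb ncoordf (y k) xN = 0.
  have -> : xN = poly_comb e (\poly_(i < N) cf x i).
    rewrite (@poly_combE _ _ _ N) ?size_poly //.
    by apply: eq_bigr => i _; rewrite coef_poly ltn_ord.
  rewrite (@comb_ncoordfE (size (y k))) // big1 // => i _; rewrite cf_comb coef_poly.
  by case: ltnP => h; rewrite ?mulr0 // HK ?mul0r.
have -> : poly_comb ncoordf (y k) x = poly_comb ncoordf (y k) (x - xN).
  by have := lin 1 (x - xN) xN I I; rewrite scale1r subrK mul1r xN0 addr0.
apply: le_trans (dual_normP _ (comb_ncoordf_dual (y k))) _.
by rewrite -/(normD (y k)) y1 mul1r HN.
Qed.

(** * Duality between the two limit norms *)

Section duality.
Variables (m : nat -> nat) (E Es : nat -> (nat -> R) -> R).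
Hypothesis minc : forall i, (m i < m i.+1)%N.
Hypothesis xE : asym normX (fun k => 'X^(m k)) E.
Hypothesis xEs : asym normD (fun k => 'X^(m k)) Es.

Let sX := normX_seminorm.
Let sD := normD_seminorm.
Let latX := asym_lattice sX (@normX_schreier) normX_X minc xE.
Let latD := asym_lattice sD (@normD_schreier) normD_X minc xEs.
Let C0 : 0 < C. Proof. exact: lt_le_trans C_ge1. Qed.
Let CC : 0 <= C ^+ 2. Proof. by rewrite exprn_ge0 // ltW. Qed.

Lemma comb_ncoordf_basis n (b : nat -> R) (k : nat -> nat) x :
  poly_comb ncoordf (\sum_(i < n) b i *: 'X^(m (k i))) x =
  \sum_(i < n) b i * ((coordf_norm (m (k i)))^-1 * cf x (m (k i))).
Proof.
rewrite poly_comb_sum fct_sumE; apply: eq_bigr => i _.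
by rewrite poly_combZ poly_combX.
Qed.

(** Functionals and basis vectors placed at the same positions are paired. The functionals are
    normalized, so [b] is first multiplied by their norms; these are at most [C], and the lattice
    property removes them at the price [2 * C ^+ 2]. *)
Lemma pairing n (a b : nat -> R) :
  \sum_(i < n) a i * b i <= 2 * C ^+ 2 * (E n a * Es n b).
Proof.
have x0 : 0 <= E n a := asym_ge0 sX xE n a.
have y0 : 0 <= Es n b := asym_ge0 sD xEs n b.
set S := \sum_(i < n) _.
suff H (d : R) : 0 < d -> S <= (E n a + d) * (2 * C ^+ 2 * Es n b + d).
  set y := 2 * C ^+ 2 * Es n b; have y1 : 0 <= y by apply: mulr_ge0 => //; apply: mulr_ge0.
  have -> : 2 * C ^+ 2 * (E n a * Es n b) = E n a * y by rewrite /y; ring.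
  apply/ler_addgt0Pr => d d0.
  (* This choice makes the error [t * (E n a + y) + t * t] of the expanded product at most [d]. *)
  pose t := Num.min 1 (d / (E n a + y + 1)).
  have s0 : 0 < E n a + y + 1 by rewrite ltr_wpDl // addr_ge0.
  have t0 : 0 < t by rewrite lt_min ltr01 divr_gt0.
  have t1 : t <= 1 by rewrite ge_min lexx.
  have t2 : t * (E n a + y + 1) <= d by rewrite -ler_pdivlMr // ge_min lexx orbT.
  apply: le_trans (H t t0) _; rewrite -/y.
  have : t * t <= t by rewrite ler_piMl // ltW.
  lra.
move=> d0.
pose B := \sum_(i < n) `|b i| * C.
have B0 : 0 <= B by apply: sumr_ge0 => i _; rewrite mulr_ge0 // ltW.
have [K1 H1] := asym_eps n a xE d0.
have [K2 H2] := asym_eps_unif n xEs B0 d0.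
pose k := addn (K1 + K2)%N; pose b' i := b i * coordf_norm (m (k i)).
have h1 : normX (\sum_(i < n) a i *: 'X^(m (k i))) <= E n a + d.
  have := H1 k (@incr_on_shift _ _); rewrite /k addn0 leq_addr => /(_ isT).
  by rewrite ler_distl => /andP[_].
have h2 : normD (\sum_(i < n) b' i *: 'X^(m (k i))) <= Es n b' + d.
  have bB i : (i < n)%N -> `|b' i| <= B.
    move=> ilt; rewrite /B (bigD1 (Ordinal ilt)) //= ler_wpDr //.
      by apply: sumr_ge0 => j _; rewrite mulr_ge0 // ltW.
    have /andP[_ w1] := coordf_norm_bounds (m (k i)).
    by rewrite normrM ler_wpM2l // gtr0_norm // coordf_norm_gt0.
  have := H2 b' k bB (@incr_on_shift _ _); rewrite {1}/k addn0 leq_addl => /(_ isT).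
  by rewrite ler_distl => /andP[_].
have h3 : Es n b' <= 2 * C ^+ 2 * Es n b.
  have -> : 2 * C ^+ 2 * Es n b = 2 * C * Es n (fun i => C * b i).
    by rewrite (asymZ sD xEs) gtr0_norm //; ring.
  apply: latD => i _; rewrite /b' !normrM mulrC ler_wpM2r //.
  rewrite (gtr0_norm C0) gtr0_norm ?coordf_norm_gt0 //.
  by have /andP[] := coordf_norm_bounds (m (k i)).
pose x := poly_comb e (\sum_(i < n) a i *: 'X^(m (k i))).
have -> : S = poly_comb ncoordf (\sum_(i < n) b' i *: 'X^(m (k i))) x.
  rewrite comb_ncoordf_basis; apply: eq_bigr => i _.
  have -> : cf x (m (k i)) = a i.
    rewrite cf_comb coef_sum (bigD1 i) //= coefZ coefXn eqxx mulr1 big1 ?addr0 // => j ji.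
    rewrite coefZ coefXn; case: eqP => [/(subseq_inj minc)/eqP|_]; last by rewrite mulr0.
    by rewrite eqn_add2l => /eqP ij; case/negP: ji; apply/eqP/val_inj.
  rewrite /b'; field; exact: lt0r_neq0 (coordf_norm_gt0 _).
apply: le_trans (ler_norm _) _.
apply: le_trans (dual_normP _ (comb_ncoordf_dual _)) _; rewrite mulrC.
apply: ler_pM => //; first exact/dual_norm_ge0/comb_ncoordf_dual.
by apply: le_trans h2 _; rewrite lerD2r.
Qed.

(** A functional norming [a] acts on [X] through the coordinates of [x] at [n] positions far out.
    These form a Schreier set, so the coordinates have [E]-norm at most [2 * C] times the norm of
    [x]; the lattice property contributes the other [2 * C]. *)
Lemma norming_dual n (a : nat -> R) : exists s : nat -> R,
  \sum_(i < n) a i * s i = E n a /\ Es n s <= 4 * C ^+ 2.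
Proof.
have [s [sa sc]] := @norming R E n a (fun a b => @asym_ext _ _ _ _ _ xE n a b)
  (fun a b => asymD sX xE n a b) (fun t a => asymZ sX xE n t a).
exists s; split=> //; apply/ler_addgt0Pr => d d0.
have [K1 H1] := asym_eps n s xEs d0.
pose k := addn (K1 + n)%N.
have := H1 k (@incr_on_shift _ _); rewrite /k addn0 leq_addr => /(_ isT).
rewrite distrC ler_distl => /andP[_ h]; apply: le_trans h _; rewrite lerD2r.
have c2 : 0 <= 4 * C ^+ 2 by apply: mulr_ge0.
apply: dual_norm_le => // x; rewrite (comb_ncoordf_basis _ _ k).
pose g i := cf x (m (k i)); pose c i := (coordf_norm (m (k i)))^-1 * g i.
have up (c' : nat -> R) : (forall i, (i < n)%N -> `|c' i| <= `|g i|) ->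
    \sum_(i < n) s i * c' i <= 4 * C ^+ 2 * `|x|.
  move=> cg; under eq_bigr do rewrite mulrC.
  apply: le_trans (sc c') _; apply: le_trans (latX cg) _.
  have Cx : 0 <= C * `|x| by rewrite mulr_ge0 // ltW.
  have -> : 4 * C ^+ 2 * `|x| = 2 * C * (C * `|x| + C * `|x|) by ring.
  rewrite ler_wpM2l ?mulr_ge0 ?(ltW C0) //.
  (* The error of [asym] is proportional to the coefficient bound [C * |x|], so the same positions
     serve for every [x], with error at most [C * |x|]. *)
  have := xE (n := n) (a := g) (k := k) Cx (fun i _ => cf_bound x _) (@incr_on_shift _ _) _.
  rewrite /k addn0 => /(_ (leqW (leq_addl _ _))).
  rewrite distrC ler_distl => /andP[_ h]; apply: le_trans h _; rewrite lerD //.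
    pose F := [seq m (k i) | i <- iota 0 n].
    have sF : schreier1 F.
      split; first by rewrite map_inj_uniq ?iota_uniq // => i j /(subseq_inj minc)/eqP; rewrite eqn_add2l => /eqP.
      move=> _ /mapP[i _ ->]; rewrite size_map size_iota; apply: leqW.
      apply: leq_trans (subseq_ge minc _); rewrite /k -addnA.
      by rewrite addnCA leq_addr.
    have := schreier_proj x sF; rewrite big_map.
    have -> : iota 0 n = index_iota 0 n by rewrite /index_iota subn0.
    rewrite big_mkord => h'; apply: le_trans h'.
    rewrite /normX poly_comb_sum le_eqVlt; apply/orP; left; apply/eqP.
    by under eq_bigr do rewrite poly_combZ poly_combX.
  by rewrite ler_pdivrMr ?ltr0n // ler_peMr // ler1n.
have cg i : (i < n)%N -> `|c i| <= `|g i|.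
  move=> _; rewrite /c normrM normfV (gtr0_norm (coordf_norm_gt0 _)) ler_piMl //.
  by have /andP[h _] := coordf_norm_bounds (m (k i)); rewrite invf_le1 ?coordf_norm_gt0.
rewrite ler_norml; apply/andP; split; last exact: (up c cg).
rewrite lerNl -sumrN; under eq_bigr do rewrite -mulrN.
by apply: (up (fun i => - c i)) => i ilt; rewrite normrN cg.
Qed.

(** Pairing with the tensor product of two norming vectors gives exactly [E n a * E l b]. [pairing]
    contributes [2 * C ^+ 2], each norming vector [4 * C ^+ 2], and [K] bounds their tensor product
    in the dual. *)
Lemma tens_lower (K : R) :
  (forall n a l b, Es (n * l) (tens l a b) <= K * Es n a * Es l b) ->
  0 < K ->
  forall n a l b, E n a * E l b <=
    2 * C ^+ 2 * (K * (4 * C ^+ 2) * (4 * C ^+ 2)) * E (n * l) (tens l a b).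
Proof.
move=> Kup K0 n a l b.
have K0' := ltW K0; have c4 : 0 <= 4 * C ^+ 2 by apply: mulr_ge0.
have [l0|l0] := posnP l.
  have -> : E l b = 0 by apply: (asym0 sX xE) => i; rewrite l0.
  rewrite mulr0; apply: mulr_ge0; last exact: (asym_ge0 sX xE).
  by apply: mulr_ge0; apply: mulr_ge0 => //; apply: mulr_ge0.
have [s [sa sE]] := norming_dual n a; have [s' [sb sE']] := norming_dual l b.
have -> : E n a * E l b = \sum_(I < n * l) tens l a b I * tens l s s' I.
  rewrite -sa -sb /tens.
  rewrite (@sum_divmod _ n l (fun i j => a i * b j * (s i * s' j))) // mulr_suml.
  apply: eq_bigr => i _; rewrite mulr_sumr; apply: eq_bigr => j _; ring.
apply: le_trans (pairing _ _ _) _; rewrite -[leRHS]mulrA; apply: ler_wpM2l.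
  by rewrite mulr_ge0.
rewrite mulrC; apply: ler_wpM2r; first exact: (asym_ge0 sX xE).
apply: le_trans (Kup _ _ _ _) _.
apply: ler_pM => //; rewrite ?(asym_ge0 sD xEs) ?mulr_ge0 ?(asym_ge0 sD xEs) //.
by apply: ler_wpM2l.
Qed.

End duality.

End basis.

(** * Assembly and transfer to an arbitrary spreading model *)

Lemma equiv_seq_trans (R : realType) (M1 M2 M3 : nat -> (nat -> R) -> R) :
  equiv_seq M1 M2 -> equiv_seq M2 M3 -> equiv_seq M1 M3.
Proof.
move=> [C1 [C10 H1]] [C2 [C20 H2]]; exists (C1 * C2); split; first exact: mulr_gt0.
move=> n a; have /andP[h1 h2] := H1 n a; have /andP[h3 h4] := H2 n a.
rewrite invfM -!mulrA; apply/andP; split.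
  apply: le_trans h1; rewrite ler_wpM2l // invr_ge0; exact: ltW.
by apply: le_trans h2 _; rewrite ler_pM2l.
Qed.

Unset Implicit Arguments.

Theorem theorem1p11 (R : realType) (X : completeNormedModType R)
  (e : nat -> X) (C : R) :
  schauder_basis e ->
  (forall i, `|e i| = 1) ->
  reflexive_space X ->
  schreier_unconditional e C ->
  SPw_single [set: X] (fun x : X => `|x|) ->
  SPw_single (@dual_set R X) (@dual_norm R X) ->
  forall (x : nat -> X) (W : normedModType R) (xt : nat -> W),
    normalized_weakly_null [set: X] (fun y : X => `|y|) x ->
    generates_spreading_model (fun y : X => `|y|) x xt ->
    equiv_seq (comb_norm xt) (@c0_norm R) \/
    exists p : R, 1 <= p /\ equiv_seq (comb_norm xt) (lp_norm p).
Proof.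
move=> basis e1 refl SUe spX spD x W xt wnx genx.
have [cf cfP] := choice (fun x : X => (basis x).1).
have cf_uniq (z : X) (a : nat -> R) :
    (fun n => \sum_(i < n) a i *: e i) @ \oo --> z -> a = cf z.
  by move=> h; exact: (basis z).2 h (@cfP z).
have C1 := C_ge1 e1 SUe; have C0 : 0 < C by exact: lt_le_trans C1.
have sX := normX_seminorm e; have X1 := normX_X e1; have suX := normX_schreier SUe.
have sD := normD_seminorm cfP cf_uniq e1 SUe.
have D1 := normD_X cfP cf_uniq e1 SUe; have suD := normD_schreier cfP cf_uniq e1 SUe.
have uniqX : unique_spreading_model (normX e).
  apply: (unique_sm_comb (S := [set: X]) (N := fun x : X => `|x|)) => //.
  exact: (weak_null_basis cfP cf_uniq e1 SUe refl).
have uniqD : unique_spreading_model (normD cf).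
  apply: (unique_sm_comb (S := @dual_set R X) (N := @dual_norm R X)) => //.
    exact: (comb_ncoordf_dual cfP cf_uniq e1 SUe).
  exact: (weak_null_dual cfP cf_uniq e1 SUe refl).
have [m1 [E [m1inc xE1]]] := brunel_sucheston sX (x := fun k => 'X^k) (B := 1)
  (fun k => eq_ind_r (fun z => z <= 1) (lexx 1) (X1 k)).
(* The second extraction is made inside the first subsequence, so that both limit norms live on the
   same positions, as duality requires. *)
have [m2 [Es [m2inc xEs]]] := brunel_sucheston sD (x := fun k => 'X^(m1 k)) (B := 1)
  (fun k => eq_ind_r (fun z => z <= 1) (lexx 1) (D1 (m1 k))).
have xE : asym (normX e) (fun k => 'X^(m1 (m2 k))) E := asym_sub xE1 m2inc.
pose m k := m1 (m2 k).
have minc i : (m i < m i.+1)%N by apply: (subseq_mono m1inc); exact: m2inc.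
have [Ku [Ku0 HKu]] := tens_upper sX suX X1 minc xE uniqX.
have [Kd [Kd0 HKd]] := tens_upper sD suD D1 minc xEs uniqD.
have Klo := tens_lower cfP cf_uniq e1 SUe minc xE xEs HKd Kd0.
set Kl := 2 * C ^+ 2 * _ in Klo.
have Eeq : equiv_seq E (@c0_norm R) \/ exists p : R, 1 <= p /\ equiv_seq E (lp_norm p).
  have C2 : 0 < 2 * C by rewrite mulr_gt0.
  have Kl0 : 0 <= Kl.
    have C4 : 0 <= C ^+ 2 by rewrite exprn_ge0 // ltW.
    by apply: mulr_ge0; apply: mulr_ge0 => //; [apply: mulr_ge0; [exact: ltW|exact: mulr_ge0]|exact: mulr_ge0].
  have E0 n a : 0 <= E n a := asym_ge0 sX xE n a.
  apply: (@multiplicative_c0_lp R E C (2 * C) (1 + Ku + Kl)) => //.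
  - by move=> n a b; exact: (asym_ext xE).
  - exact: (asymD sX xE).
  - exact: (asymZ sX xE).
  - exact: (asym_lattice sX suX X1 minc xE).
  - exact: (asym_coef sX suX X1 minc xE).
  - by move=> n P; exact: (asym_indicator n P xE).
  - exact: (asym_single X1 xE).
  - by rewrite -addrA lerDl addr_ge0 // ltW.
  - move=> n a l b; apply: le_trans (HKu n a l b) _; rewrite -!mulrA.
    rewrite ler_wpM2r ?mulr_ge0 //; lra.
  - move=> n a l b; apply: le_trans (Klo n a l b) _.
    rewrite ler_wpM2r //; lra.
have [W1 [xt1 [xtE1 gen1]]] := asym_basis_generates sX suX X1 minc xE.
have xt1E : comb_norm xt1 = E by apply/funext => n; apply/funext => a; exact: xtE1.
(* [E] is itself the norm of a spreading model of a subsequence of the basis, which is weakly null,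
   so uniqueness carries the result over to [xt]. *)
have eqx : equiv_seq (comb_norm xt) E.
  rewrite -xt1E; apply: (spX.2 x W xt (poly_comb e \o (fun k => 'X^(m k))) W1 xt1) => //.
    apply: vanishing_normalized => //.
    - exact: (weak_null_basis cfP cf_uniq e1 SUe refl).
    - exact: vanishing_basis minc.
    - by move=> k; exact: X1.
  exact: (generates_comb (N := fun x : X => `|x|) gen1).
case: Eeq => [h|[p [p1 h]]]; [left|right; exists p; split=> //]; exact: equiv_seq_trans h.
Qed.
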